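(* Let $\mathbf{P}$ be the category of Polish groups and continuous group homomorphisms, let $\mathbf{PC}$ be the category of groups with a Polish cover and Borel-definable homomorphisms, and let $\mathcal S$ be a regular subcategory of $\mathbf{P}$. Let $\mathcal S\mathbf C$ be the (not necessarily full) subcategory of $\mathbf{PC}$ that has $\mathcal S$-groups with a Polish cover as objects and $\mathcal S$-definable homomorphisms as morphisms. Then the canonical equivalence $\mathrm{Ex}(\mathbf{P})\simeq\mathbf{PC}$ restricts to an equivalence $\mathrm{Ex}(\mathcal S)\simeq\mathcal S\mathbf C$.
   Context: A subgroup $N$ of a Polish group $G$ is a Polish subgroup if it carries a (necessarily unique) Polish group topology for which the inclusion $N\to G$ is continuous; it is then always considered with this topology. A group with a Polish cover is a quotient group $G/N$ where $G$ is a Polish group and $N$ is a normal Polish subgroup of $G$ (the pair $(G,N)$ is part of the data). A group homomorphism $f:G/N\to H/M$ is Borel-definable if there is a Borel function $\tilde f:G\to H$ with $f(gN)=\tilde f(g)M$ for all $g\in G$; in this case the lifted graph $\widehat\Gamma(f)=\{(g,h)\in G\times H:f(gN)=hM\}$ is a Polish subgroup of $G\times H$. The coset relation $E_N^G=\{(g,h)\in G\times G: gN=hN\}$ is a Polish subgroup of $G\times G$. A functor between regular categories is regular if it preserves finite limits and regular epimorphisms. A regular subcategory of a regular category $\mathcal C$ is a full subcategory that is itself a regular category and whose inclusion functor into $\mathcal C$ is regular. The category $\mathbf P$ is regular, with regular epimorphisms the surjective continuous homomorphisms. An $\mathcal S$-group with a Polish cover is a group with a Polish cover $G/N$ such that both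 $G$ and $E_N^G$ are in $\mathcal S$ (up to isomorphism of Polish groups). A group homomorphism $f:G/N\to H/M$ between $\mathcal S$-groups with a Polish cover is $\mathcal S$-definable if it is Borel-definable and its lifted graph $\widehat\Gamma(f)$, with its canonical Polish group topology as a Polish subgroup of $G\times H$, is isomorphic to an object of $\mathcal S$. Exact completion (ex/reg completion). Let $\mathcal C$ be a regular category. A relation from $X$ to $Y$ is a subobject $R\hookrightarrow X\times Y$. The composite $SR$ of a relation $R$ from $X$ to $Y$ with a relation $S$ from $Y$ to $Z$ is the regular image of $R\times_Y S\to X\times Z$; $R^\circ$ is the opposite relation, $\leq$ the inclusion of subobjects. The objects of $\mathrm{Ex}(\mathcal C)$ are pairs $(X,R)$ with $R$ an internal equivalence relation on the object $X$ of $\mathcal C$. A morphism $(X,R)\to (Y,S)$ is a relation $T$ from $X$ to $Y$ such that $TR=T=ST$, $R\leq T^\circ T$, and $TT^\circ\leq S$. Composition is composition of relations, and the identity of $(X,R)$ is $R$. The inclusion $\mathcal S\to\mathbf P$ induces a canonical functor $\mathrm{Ex}(\mathcal S)\to\mathrm{Ex}(\mathbf P)$, $(X,R)\mapsto (X,R)$, $T\mapsto T$. The canonical equivalence $\mathrm{Ex}(\mathbf P)\simeq\mathbf{PC}$ sends an internal equivalence relation on $G$, which is necessarily of the form $E_N^G$ for a normal Polish subgroup $N$ of $G$, to $G/N$, and sends a morphism $T:(G,E_N^G)\to(H,E_M^H)$ to the homomorphism $f_T:G/N\to H/M$ with $f_T(gN)=hM$ whenever $(g,h)\in T$. That it ''restricts''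 means that its composite with $\mathrm{Ex}(\mathcal S)\to\mathrm{Ex}(\mathbf P)$ is an equivalence onto the indicated subcategory. *)

(* Defs.v *)
From HB Require Import structures.
From Corelib Require Setoid Morphisms RelationClasses.
From mathcomp Require Import all_boot all_order all_algebra.
From mathcomp Require Import all_classical all_reals.
From mathcomp Require Import topology.
From mathcomp Require Import measurable_structure.
From mathcomp Require Import Rstruct.

Set Implicit Arguments.
Unset Strict Implicit.
Unset Printing Implicit Defensive.

Import Order.TTheory GRing.Theory Num.Theory.

Local Open Scope classical_set_scope.

(* Categories whose hom-types carry an equivalence relation [eqh], the equality
   of morphisms.  This is needed because morphisms of an exact completion are
   subobjects, that is, monomorphisms up to isomorphism. *)

Declare Scope cat_scope.
Delimit Scope cat_scope with cat.

Record category := Category {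
  ob :> Type;
  hom : ob -> ob -> Type;
  eqh : forall X Y, hom X Y -> hom X Y -> Prop;
  idh : forall X, hom X X;
  comph : forall X Y Z, hom Y Z -> hom X Y -> hom X Z;
  eqh_refl : forall X Y (f : hom X Y), eqh f f;
  eqh_sym : forall X Y (f g : hom X Y), eqh f g -> eqh g f;
  eqh_trans : forall X Y (f g h : hom X Y), eqh f g -> eqh g h -> eqh f h;
  comph_eqh : forall X Y Z (g g' : hom Y Z) (f f' : hom X Y),
    eqh g g' -> eqh f f' -> eqh (comph g f) (comph g' f');
  comphA : forall X Y Z W (h : hom Z W) (g : hom Y Z) (f : hom X Y),
    eqh (comph h (comph g f)) (comph (comph h g) f);
  comp1h : forall X Y (f : hom X Y), eqh (comph (idh Y) f) f;
  comph1 : forall X Y (f : hom X Y), eqh (comph f (idh X)) f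
}.
Arguments hom {c} X Y.
Arguments eqh {c X Y} f g.
Arguments idh {c} X.
Arguments comph {c X Y Z} g f.

Notation "f =h g" := (eqh f g) (at level 70, no associativity) : cat_scope.
Notation "g \oh f" := (comph g f) (at level 50, left associativity) : cat_scope.
Local Open Scope cat_scope.

Instance eqh_equivalence (C : category) (X Y : C) : RelationClasses.Equivalence (@eqh C X Y).
Proof.
split; [exact: eqh_refl|exact: eqh_sym|move=> f g h; exact: eqh_trans].
Qed.

Instance comph_proper (C : category) (X Y Z : C) :
  Morphisms.Proper (Morphisms.respectful (@eqh C Y Z)
    (Morphisms.respectful (@eqh C X Y) (@eqh C X Z))) (@comph C X Y Z).
Proof. by move=> g g' gg f f' ff; apply: comph_eqh. Qed.

Record functor_on (C D : category) (F : C -> D) := FunctorOn {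
  fmap_of : forall X Y, hom X Y -> hom (F X) (F Y);
  fmap_of_eqh : forall X Y (f g : hom X Y), f =h g -> fmap_of f =h fmap_of g;
  fmap_of_id : forall X, fmap_of (idh X) =h idh (F X);
  fmap_of_comp : forall X Y Z (g : hom Y Z) (f : hom X Y),
    fmap_of (g \oh f) =h fmap_of g \oh fmap_of f
}.

Record functor (C D : category) := Functor {
  fob :> C -> D;
  fon : functor_on fob
}.

Definition fmap (C D : category) (F : functor C D) (X Y : C) (f : hom X Y)
  : hom (F X) (F Y) := fmap_of (fon F) f.

Lemma fmap_eqh (C D : category) (F : functor C D) (X Y : C) (f g : hom X Y) :
  f =h g -> fmap F f =h fmap F g.
Proof. exact: fmap_of_eqh. Qed.

Lemma fmap_id (C D : category) (F : functor C D) (X : C) :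
  fmap F (idh X) =h idh (F X).
Proof. exact: fmap_of_id. Qed.

Lemma fmap_comp (C D : category) (F : functor C D) (X Y Z : C)
  (g : hom Y Z) (f : hom X Y) : fmap F (g \oh f) =h fmap F g \oh fmap F f.
Proof. exact: fmap_of_comp. Qed.

Definition functor_id (C : category) : functor C C.
Proof.
apply: (@Functor C C id (@FunctorOn _ _ _ (fun X Y f => f) _ _ _)) => //=;
  by move=> *; reflexivity.
Defined.

Definition functor_comp (C D E : category) (G : functor D E) (F : functor C D) :
  functor C E.
Proof.
apply: (@Functor C E (fun X => G (F X))
  (@FunctorOn _ _ _ (fun X Y f => fmap G (fmap F f)) _ _ _)).
- by move=> X Y f g fg; do 2 apply: fmap_eqh.
- move=> X; apply: eqh_trans (fmap_id G (F X)).
  by apply: fmap_eqh; apply: fmap_id.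
- move=> X Y Z g f; apply: eqh_trans (fmap_comp G _ _).
  by apply: fmap_eqh; apply: fmap_comp.
Defined.

Definition is_iso (C : category) (X Y : C) (f : hom X Y) : Prop :=
  exists g : hom Y X, g \oh f =h idh X /\ f \oh g =h idh Y.

Definition isomorphic (C : category) (X Y : C) : Prop :=
  exists f : hom X Y, is_iso f.

Definition naturally_isomorphic (C D : category) (F G : functor C D) : Prop :=
  exists a : forall X, hom (F X) (G X),
    (forall X, is_iso (a X)) /\
    (forall X Y (f : hom X Y), a Y \oh fmap F f =h fmap G f \oh a X).

Definition is_equivalence (C D : category) (F : functor C D) : Prop :=
  exists G : functor D C,
    naturally_isomorphic (functor_comp G F) (functor_id C) /\
    naturally_isomorphic (functor_comp F G) (functor_id D).

Definition full_subcategory (C : category) (S : C -> Prop) : category.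
Proof.
apply: (@Category {X : C | S X} (fun X Y => hom (sval X) (sval Y))
  (fun X Y f g => f =h g) (fun X => idh (sval X)) (fun X Y Z g f => g \oh f)).
- by move=> *; apply: eqh_refl.
- by move=> *; apply: eqh_sym.
- by move=> X Y f g h; apply: eqh_trans.
- by move=> *; apply: comph_eqh.
- by move=> *; apply: comphA.
- by move=> *; apply: comp1h.
- by move=> *; apply: comph1.
Defined.

Definition full_inclusion (C : category) (S : C -> Prop) :
  functor (full_subcategory S) C.
Proof.
apply: (@Functor (full_subcategory S) C (fun X => sval X)
  (@FunctorOn (full_subcategory S) C _ (fun X Y f => f) _ _ _)) => //=;
  by move=> *; reflexivity.
Defined.

(* A not necessarily full subcategory is given by a class of objects and a class
   of morphisms; only the morphisms between objects of the class matter. *)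
Definition is_subcategory (D : category) (Sob : D -> Prop)
    (Shom : forall X Y : D, hom X Y -> Prop) : Prop :=
  [/\ forall X Y (f g : hom X Y), Sob X -> Sob Y -> f =h g ->
        Shom _ _ f -> Shom _ _ g,
      forall X, Sob X -> Shom _ _ (idh X)
    & forall X Y Z (g : hom Y Z) (f : hom X Y), Sob X -> Sob Y -> Sob Z ->
        Shom _ _ g -> Shom _ _ f -> Shom _ _ (g \oh f)].

Definition subcategory (D : category) (Sob : D -> Prop)
  (Shom : forall X Y : D, hom X Y -> Prop) (h : is_subcategory Sob Shom) :
  category.
Proof.
apply: (@Category {X : D | Sob X}
  (fun X Y => {f : hom (sval X) (sval Y) | Shom _ _ f})
  (fun X Y f g => sval f =h sval g)
  (fun X => exist _ (idh (sval X)) (let: And3 _ h1 _ := h in h1 _ (svalP X)))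
  (fun X Y Z g f => exist _ (sval g \oh sval f)
    (let: And3 _ _ h2 := h in
     h2 _ _ _ _ _ (svalP X) (svalP Y) (svalP Z) (svalP g) (svalP f)))).
- by move=> *; apply: eqh_refl.
- by move=> *; apply: eqh_sym.
- by move=> X Y f g k; apply: eqh_trans.
- by move=> *; apply: comph_eqh.
- by move=> *; apply: comphA.
- by move=> *; apply: comp1h.
- by move=> *; apply: comph1.
Defined.

Definition corestriction (C D : category) (F : functor C D) (Sob : D -> Prop)
  (Shom : forall X Y : D, hom X Y -> Prop) (h : is_subcategory Sob Shom)
  (ho : forall X, Sob (F X))
  (hm : forall X Y (f : hom X Y), Shom _ _ (fmap F f)) :
  functor C (subcategory h).
Proof.
apply: (@Functor C (subcategory h) (fun X => exist Sob (F X) (ho X))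
  (@FunctorOn C (subcategory h) (fun X => exist Sob (F X) (ho X))
    (fun X Y f => exist (Shom (F X) (F Y)) (fmap F f) (hm X Y f)) _ _ _)).
- by move=> *; apply: fmap_eqh.
- by move=> *; apply: fmap_id.
- by move=> *; apply: fmap_comp.
Defined.

Definition equivalence_onto (C D : category) (F : functor C D) (Sob : D -> Prop)
    (Shom : forall X Y : D, hom X Y -> Prop) (h : is_subcategory Sob Shom) :
  Prop :=
  exists (ho : forall X, Sob (F X))
         (hm : forall X Y (f : hom X Y), Shom _ _ (fmap F f)),
    is_equivalence (corestriction h ho hm).

(* Finite limits are limits of diagrams indexed by finite directed graphs; a
   functor from a finite category has the same cones as its underlying graph
   diagram. *)
Record diagram (C : category) := Diagram {
  vertex : finType;
  edge : finType;
  source : edge -> vertex;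
  target : edge -> vertex;
  dob : vertex -> C;
  darr : forall e, hom (dob (source e)) (dob (target e))
}.
Arguments darr {C} d e.

Definition is_cone (C : category) (D : diagram C) (L : C)
    (p : forall v, hom L (dob (d := D) v)) : Prop :=
  forall e, darr D e \oh p (source e) =h p (target e).

Definition is_limit (C : category) (D : diagram C) (L : C)
    (p : forall v, hom L (dob (d := D) v)) : Prop :=
  is_cone p /\
  forall U (u : forall v, hom U (dob (d := D) v)), is_cone u ->
    exists f : hom U L, (forall v, p v \oh f =h u v) /\
      forall g : hom U L, (forall v, p v \oh g =h u v) -> g =h f.

Definition has_finite_limits (C : category) : Prop :=
  forall D : diagram C, exists L (p : forall v, hom L (dob (d := D) v)),
    is_limit p.

Definition fmap_diagram (C D : category) (F : functor C D) (G : diagram C) :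
  diagram D :=
  @Diagram D (vertex G) (edge G) (@source _ G) (@target _ G)
    (fun v => F (dob v)) (fun e => fmap F (darr G e)).

Definition preserves_finite_limits (C D : category) (F : functor C D) : Prop :=
  forall (G : diagram C) (L : C) (p : forall v, hom L (dob (d := G) v)),
    is_limit p -> @is_limit D (fmap_diagram F G) (F L) (fun v => fmap F (p v)).

Definition is_pullback (C : category) (X Y Z P : C) (f : hom X Z) (g : hom Y Z)
    (p : hom P X) (q : hom P Y) : Prop :=
  f \oh p =h g \oh q /\
  forall U (u : hom U X) (v : hom U Y), f \oh u =h g \oh v ->
    exists w : hom U P, (p \oh w =h u /\ q \oh w =h v) /\
      forall w', p \oh w' =h u -> q \oh w' =h v -> w' =h w.

Definition is_coequalizer (C : category) (A B Q : C) (f g : hom A B)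
    (q : hom B Q) : Prop :=
  q \oh f =h q \oh g /\
  forall U (u : hom B U), u \oh f =h u \oh g ->
    exists w : hom Q U, w \oh q =h u /\ forall w', w' \oh q =h u -> w' =h w.

Definition regular_epi (C : category) (B Q : C) (q : hom B Q) : Prop :=
  exists A (f g : hom A B), is_coequalizer f g q.

Record regular (C : category) : Prop := Regular {
  regular_limits : has_finite_limits C;
  regular_kernel_pairs : forall (X Y P : C) (f : hom X Y) (p q : hom P X),
    is_pullback f f p q -> exists Q (c : hom X Q), is_coequalizer p q c;
  regular_stable : forall (X Y Z P : C) (f : hom X Z) (g : hom Y Z)
    (p : hom P X) (q : hom P Y),
    is_pullback f g p q -> regular_epi g -> regular_epi p
}.

Record regular_functor (C D : category) (F : functor C D) : Prop :=
  RegularFunctor {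
    regular_functor_limits : preserves_finite_limits F;
    regular_functor_epi : forall X Y (e : hom X Y),
      regular_epi e -> regular_epi (fmap F e)
  }.

Record regular_subcategory (C : category) (S : C -> Prop) : Prop :=
  RegularSubcategory {
    subcategory_regular : regular (full_subcategory S);
    inclusion_regular : regular_functor (full_inclusion S)
  }.

(* A relation is a monomorphism R -> X x Y, presented by its two components;
   relations are compared by inclusion and identified when they include each
   other, that is, when they are the same subobject of X x Y. *)
Definition jointly_monic (C : category) (R X Y : C) (l : hom R X) (r : hom R Y) :
  Prop :=
  forall U (u v : hom U R), l \oh u =h l \oh v -> r \oh u =h r \oh v -> u =h v.

Record crel (C : category) (X Y : C) := CRel {
  crel_ob : C;
  crel_l : hom crel_ob X;
  crel_r : hom crel_ob Y;
  crel_monic : jointly_monic crel_l crel_r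
}.
Arguments crel_ob {C X Y} c.
Arguments crel_l {C X Y} c.
Arguments crel_r {C X Y} c.

Definition crel_le (C : category) (X Y : C) (R S : crel X Y) : Prop :=
  exists i : hom (crel_ob R) (crel_ob S),
    crel_l S \oh i =h crel_l R /\ crel_r S \oh i =h crel_r R.

Definition crel_eq (C : category) (X Y : C) (R S : crel X Y) : Prop :=
  crel_le R S /\ crel_le S R.

Lemma jointly_monic_op (C : category) (X Y : C) (R : crel X Y) :
  jointly_monic (crel_r R) (crel_l R).
Proof. by move=> U u v hr hl; apply: (crel_monic (c := R)). Qed.

Definition crel_op (C : category) (X Y : C) (R : crel X Y) : crel Y X :=
  CRel (jointly_monic_op (R := R)).

Lemma jointly_monic_diag (C : category) (X : C) :
  jointly_monic (idh X) (idh X).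
Proof. by move=> U u v; rewrite !comp1h. Qed.

Definition crel_diag (C : category) (X : C) : crel X X :=
  CRel (@jointly_monic_diag C X).

Definition is_composite (C : category) (X Y Z : C) (S : crel Y Z) (R : crel X Y)
    (T : crel X Z) : Prop :=
  exists P (p : hom P (crel_ob R)) (q : hom P (crel_ob S))
    (e : hom P (crel_ob T)),
    [/\ is_pullback (crel_r R) (crel_l S) p q, regular_epi e,
        crel_l T \oh e =h crel_l R \oh p & crel_r T \oh e =h crel_r S \oh q].

Record equivalence_relation (C : category) (X : C) (R : crel X X) : Prop :=
  EquivalenceRelation {
    eqrel_refl : crel_le (crel_diag X) R;
    eqrel_sym : crel_le (crel_op R) R;
    eqrel_trans : forall P (p q : hom P (crel_ob R)),
      is_pullback (crel_r R) (crel_l R) p q ->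
      exists t : hom P (crel_ob R),
        crel_l R \oh t =h crel_l R \oh p /\ crel_r R \oh t =h crel_r R \oh q
  }.

(* Generalized elements of a relation. *)
Definition crel_mem (C : category) (X Y : C) (R : crel X Y) (U : C)
    (x : hom U X) (y : hom U Y) : Prop :=
  exists u : hom U (crel_ob R), crel_l R \oh u =h x /\ crel_r R \oh u =h y.

Section Limits.
Variable C : category.
Hypothesis limC : has_finite_limits C.

Definition cospan (X Y Z : C) (f : hom X Z) (g : hom Y Z) : diagram C :=
  @Diagram C (option bool) bool Some (fun=> None)
    (fun v => match v with Some b => if b then X else Y | None => Z end)
    (fun b => match b as b0 return hom (if b0 then X else Y) Z with
              | true => f | false => g end).

Lemma ex_pullback (X Y Z : C) (f : hom X Z) (g : hom Y Z) :
  exists P (p : hom P X) (q : hom P Y), is_pullback f g p q.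
Proof.
have [P [p [cp up]]] := limC (cospan f g).
exists P, (p (Some true)), (p (Some false)); split.
  by apply: eqh_trans (cp true) _; apply: eqh_sym; apply: (cp false).
move=> U u v uv.
have [|w [pw uw]] := up U (fun a : option bool =>
  match a as a0 return hom U (dob (d := cospan f g) a0) with
  | Some true => u | Some false => v | None => f \oh u end).
  by case=> /=; [reflexivity|symmetry].
exists w; split; first by split; [apply: (pw (Some true))|apply: (pw (Some false))].
move=> w' pw' qw'; apply: uw => -[[]|] //=.
apply: eqh_trans (comph_eqh (eqh_refl f) pw').
apply: eqh_trans (eqh_sym (comphA _ _ _)).
apply: comph_eqh (eqh_refl _).
by apply: eqh_sym; apply: (cp true).
Qed.

Definition discrete2 (X Y : C) : diagram C :=
  @Diagram C bool void (fun e => match e with end) (fun e => match e with end)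
    (fun b => if b then X else Y) (fun e => match e with end).

Lemma ex_product (X Y : C) : exists P (p : hom P X) (q : hom P Y),
  jointly_monic p q /\
  forall U (u : hom U X) (v : hom U Y),
    exists w : hom U P, p \oh w =h u /\ q \oh w =h v.
Proof.
have [P [p [_ up]]] := limC (discrete2 X Y).
exists P, (p true), (p false); split.
  move=> U u v h1 h2.
  have [|w [_ uw]] := up U (fun b => p b \oh v); first by case.
  have -> : u =h w by apply: uw => -[].
  by symmetry; apply: uw => b; reflexivity.
move=> U u v.
have [|w [pw _]] := up U (fun b : bool =>
  match b as b0 return hom U (if b0 then X else Y) with
  | true => u | false => v end); first by case.
by exists w; split; [apply: (pw true)|apply: (pw false)].
Qed.

End Limits.

Lemma regular_epi_epi (C : category) (X Y Z : C) (e : hom X Y) (a b : hom Y Z) :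
  regular_epi e -> a \oh e =h b \oh e -> a =h b.
Proof.
move=> [A [f [g [fg ue]]]] ab.
have [|w [_ uw]] := ue _ (b \oh e).
  by rewrite -!comphA; apply: comph_eqh => //; reflexivity.
have -> : a =h w by apply: uw.
by symmetry; apply: uw; reflexivity.
Qed.

Lemma ex_composite (C : category) (regC : regular C) (X Y Z : C)
    (S : crel Y Z) (R : crel X Y) : exists T : crel X Z, is_composite S R T.
Proof.
have limC := regular_limits regC.
have [P [p [q pq]]] := ex_pullback limC (crel_r R) (crel_l S).
have [W [w1 [w2 [wm wu]]]] := ex_product limC X Z.
have [k [k1 k2]] := wu _ (crel_l R \oh p) (crel_r S \oh q).
have [K [a [b ab]]] := ex_pullback limC k k.
have [Q [c cab]] := regular_kernel_pairs regC ab.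
have [m [mc _]] := cab.2 _ k ab.1.
have ec : regular_epi c by exists K, a, b.
have mm : jointly_monic (w1 \oh m) (w2 \oh m).
  move=> U u v; rewrite -!comphA => h1 h2; have muv := wm _ _ _ h1 h2.
  have [V1 [e1 [x1 pb1]]] := ex_pullback limC u c.
  have [V2 [e2 [x2 pb2]]] := ex_pullback limC (v \oh e1) c.
  have re1 := regular_stable regC pb1 ec.
  have re2 := regular_stable regC pb2 ec.
  apply: (regular_epi_epi re1); apply: (regular_epi_epi re2).
  have h : k \oh (x1 \oh e2) =h k \oh x2.
    rewrite -mc -!comphA -pb2.1 (comphA c) -pb1.1 !comphA muv; reflexivity.
  have [t [[t1 t2] _]] := ab.2 _ _ _ h.
  rewrite pb2.1 pb1.1 -comphA -t1 -t2 !comphA cab.1; reflexivity.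
exists (CRel mm), P, p, q, c; split => //=.
  by rewrite -k1 -mc comphA; reflexivity.
by rewrite -k2 -mc comphA; reflexivity.
Qed.

(* The composite SR, as a chosen representative of the regular image. *)
Definition crel_comp (C : category) (regC : regular C) (X Y Z : C)
    (S : crel Y Z) (R : crel X Y) : crel X Z :=
  sval (cid (ex_composite regC S R)).

Section Elements.
Variables (C : category).
Hypothesis regC : regular C.

Lemma crel_le_mem (X Y : C) (R S : crel X Y) : crel_le R S <->
  forall U (x : hom U X) (y : hom U Y), crel_mem R x y -> crel_mem S x y.
Proof.
split=> [[i [il ir]] U x y [u [ul ur]]|h].
  by exists (i \oh u); rewrite !comphA il ir.
apply: (h _ (crel_l R) (crel_r R)); exists (idh _).
by split; apply: comph1.
Qed.

Lemma crel_mem_eqh (X Y : C) (R : crel X Y) U (x x' : hom U X) (y y' : hom U Y) :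
  x =h x' -> y =h y' -> crel_mem R x y -> crel_mem R x' y'.
Proof. by move=> xx yy [u [ul ur]]; exists u; rewrite ul ur. Qed.

Lemma crel_mem_comp (X Y : C) (R : crel X Y) U V (x : hom U X) (y : hom U Y)
  (e : hom V U) : crel_mem R x y -> crel_mem R (x \oh e) (y \oh e).
Proof.
by move=> [u [ul ur]]; exists (u \oh e); rewrite !comphA ul ur; split; reflexivity.
Qed.

Lemma crel_mem_descent (X Y : C) (R : crel X Y) U V (x : hom U X) (y : hom U Y)
  (e : hom V U) : regular_epi e -> crel_mem R (x \oh e) (y \oh e) ->
  crel_mem R x y.
Proof.
move=> re [w [wl wr]]; have [A [f [g [fg ue]]]] := re.
have [|u [ue1 _]] := ue _ w.
  apply: (crel_monic (c := R)); rewrite !comphA ?wl ?wr -!comphA fg; reflexivity.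
by exists u; split; apply: (regular_epi_epi re); rewrite -comphA ue1.
Qed.

Lemma composite_mem (X Y Z : C) (S : crel Y Z) (R : crel X Y) (T : crel X Z)
    U (x : hom U X) (y : hom U Y) (z : hom U Z) : is_composite S R T ->
  crel_mem R x y -> crel_mem S y z -> crel_mem T x z.
Proof.
move=> [P [p [q [e [pb _ el er]]]]] [u [ul ur]] [v [vl vr]].
have [|w [[wu wv] _]] := pb.2 _ u v; first by rewrite ur vl; reflexivity.
exists (e \oh w); rewrite !comphA el er -!comphA wu wv; by split.
Qed.

Lemma mem_composite (X Y Z : C) (S : crel Y Z) (R : crel X Y) (T : crel X Z)
    U (x : hom U X) (z : hom U Z) : is_composite S R T -> crel_mem T x z ->
  exists V (e : hom V U) (y : hom V Y),
    [/\ regular_epi e, crel_mem R (x \oh e) y & crel_mem S y (z \oh e)].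
Proof.
move=> [P [p [q [e [pb re el er]]]]] [t [tl tr]].
have [V [d [s ds]]] := ex_pullback (regular_limits regC) t e.
exists V, d, (crel_r R \oh p \oh s); split.
- exact: (regular_stable regC ds re).
- exists (p \oh s); split; last by rewrite comphA; reflexivity.
  by rewrite comphA -el -comphA -ds.1 comphA tl; reflexivity.
- exists (q \oh s); split; first by rewrite comphA -pb.1; reflexivity.
  by rewrite comphA -er -comphA -ds.1 comphA tr; reflexivity.
Qed.

Lemma crel_compP (X Y Z : C) (S : crel Y Z) (R : crel X Y) :
  is_composite S R (crel_comp regC S R).
Proof. exact: svalP (cid (ex_composite regC S R)). Qed.

Lemma crel_comp_mem (X Y Z : C) (S : crel Y Z) (R : crel X Y)
    U (x : hom U X) (y : hom U Y) (z : hom U Z) :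
  crel_mem R x y -> crel_mem S y z -> crel_mem (crel_comp regC S R) x z.
Proof. exact: composite_mem (crel_compP S R). Qed.

Lemma mem_crel_comp (X Y Z : C) (S : crel Y Z) (R : crel X Y)
    U (x : hom U X) (z : hom U Z) : crel_mem (crel_comp regC S R) x z ->
  exists V (e : hom V U) (y : hom V Y),
    [/\ regular_epi e, crel_mem R (x \oh e) y & crel_mem S y (z \oh e)].
Proof. exact: mem_composite (crel_compP S R). Qed.

Lemma crel_mem_op (X Y : C) (R : crel X Y) U (x : hom U X) (y : hom U Y) :
  crel_mem (crel_op R) y x <-> crel_mem R x y.
Proof. by split=> -[u [ul ur]]; exists u. Qed.

Lemma crel_le_refl (X Y : C) (R : crel X Y) : crel_le R R.
Proof. by apply/crel_le_mem. Qed.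

Lemma crel_le_trans (X Y : C) (R S T : crel X Y) :
  crel_le R S -> crel_le S T -> crel_le R T.
Proof.
by move=> /crel_le_mem RS /crel_le_mem ST; apply/crel_le_mem=> U x y /RS /ST.
Qed.

Lemma crel_eq_sym (X Y : C) (R S : crel X Y) : crel_eq R S -> crel_eq S R.
Proof. by case. Qed.

Lemma crel_eq_trans (X Y : C) (R S T : crel X Y) :
  crel_eq R S -> crel_eq S T -> crel_eq R T.
Proof.
by move=> [a b] [c d]; split; [apply: crel_le_trans a c|apply: crel_le_trans d b].
Qed.

Lemma crel_comp_le (X Y Z : C) (S S' : crel Y Z) (R R' : crel X Y) :
  crel_le S S' -> crel_le R R' ->
  crel_le (crel_comp regC S R) (crel_comp regC S' R').
Proof.
move=> /crel_le_mem SS /crel_le_mem RR; apply/crel_le_mem => U x z.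
move=> /mem_crel_comp [V [e [y [re /RR xy /SS yz]]]].
by apply: (crel_mem_descent re); apply: crel_comp_mem yz.
Qed.

Lemma crel_comp_eq (X Y Z : C) (S S' : crel Y Z) (R R' : crel X Y) :
  crel_eq S S' -> crel_eq R R' ->
  crel_eq (crel_comp regC S R) (crel_comp regC S' R').
Proof. by move=> [a b] [c d]; split; apply: crel_comp_le. Qed.

Lemma crel_compA (X Y Z W : C) (T : crel Z W) (S : crel Y Z) (R : crel X Y) :
  crel_eq (crel_comp regC T (crel_comp regC S R))
          (crel_comp regC (crel_comp regC T S) R).
Proof.
split; apply/crel_le_mem => U x w.
  move=> /mem_crel_comp [V [e [z [re /mem_crel_comp [V' [e' [y [re' xy yz]]]] zw]]]].
  apply: (crel_mem_descent re); apply: (crel_mem_descent re').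
  apply: crel_comp_mem xy _; apply: crel_comp_mem yz _.
  exact: crel_mem_comp.
move=> /mem_crel_comp [V [e [y [re xy /mem_crel_comp [V' [e' [z [re' yz zw]]]]]]]].
apply: (crel_mem_descent re); apply: (crel_mem_descent re').
apply: crel_comp_mem zw; apply: crel_comp_mem yz.
exact: crel_mem_comp.
Qed.

Lemma equivalence_relation_mem_trans (X : C) (R : crel X X) U (x y z : hom U X) :
  equivalence_relation R -> crel_mem R x y -> crel_mem R y z -> crel_mem R x z.
Proof.
move=> eR [u [ul ur]] [v [vl vr]].
have [P [p [q pb]]] := ex_pullback (regular_limits regC) (crel_r R) (crel_l R).
have [t [tl tr]] := eqrel_trans eR pb.
have [|w [[wu wv] _]] := pb.2 _ u v; first by rewrite ur vl; reflexivity.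
by exists (t \oh w); rewrite !comphA tl tr -!comphA wu wv.
Qed.

Lemma equivalence_relation_mem_sym (X : C) (R : crel X X) U (x y : hom U X) :
  equivalence_relation R -> crel_mem R x y -> crel_mem R y x.
Proof.
move=> eR /crel_mem_op; apply: (proj1 (crel_le_mem _ _) (eqrel_sym eR)).
Qed.

Lemma equivalence_relation_mem_refl (X : C) (R : crel X X) U (x : hom U X) :
  equivalence_relation R -> crel_mem R x x.
Proof.
move=> eR; apply: (proj1 (crel_le_mem _ _) (eqrel_refl eR)).
by exists x; split; apply: comp1h.
Qed.

Lemma equivalence_relation_idem (X : C) (R : crel X X) :
  equivalence_relation R -> crel_eq (crel_comp regC R R) R.
Proof.
move=> eR; split; apply/crel_le_mem => U x z.
  move=> /mem_crel_comp [V [e [y [re xy yz]]]]; apply: (crel_mem_descent re).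
  exact: equivalence_relation_mem_trans yz.
by move=> xz; apply: crel_comp_mem xz; apply: equivalence_relation_mem_refl.
Qed.

End Elements.

Record ex_ob (C : category) := ExOb {
  ex_carrier : C;
  ex_rel : crel ex_carrier ex_carrier;
  ex_equiv : equivalence_relation ex_rel
}.
Arguments ex_carrier {C} e.
Arguments ex_rel {C} e.

Record ex_hom (C : category) (regC : regular C) (A B : ex_ob C) := ExHom {
  ex_graph : crel (ex_carrier A) (ex_carrier B);
  ex_source : crel_eq (crel_comp regC ex_graph (ex_rel A)) ex_graph;
  ex_target : crel_eq (crel_comp regC (ex_rel B) ex_graph) ex_graph;
  ex_total :
    crel_le (ex_rel A) (crel_comp regC (crel_op ex_graph) ex_graph);
  ex_functional :
    crel_le (crel_comp regC ex_graph (crel_op ex_graph)) (ex_rel B)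
}.
Arguments ex_graph {C regC A B} e.

Section ExactCompletion.
Variables (C : category) (regC : regular C).
Local Notation "S \r R" := (crel_comp regC S R) (at level 40).

Lemma ex_id_total (A : ex_ob C) :
  crel_le (ex_rel A) (crel_op (ex_rel A) \r ex_rel A).
Proof.
apply/crel_le_mem => U x y xy; apply: crel_comp_mem xy _.
by apply/crel_mem_op; apply: equivalence_relation_mem_refl (ex_equiv A).
Qed.

Lemma ex_id_functional (A : ex_ob C) :
  crel_le (ex_rel A \r crel_op (ex_rel A)) (ex_rel A).
Proof.
apply: crel_le_trans (equivalence_relation_idem regC (ex_equiv A)).1.
by apply: crel_comp_le; [apply: crel_le_refl|apply: eqrel_sym (ex_equiv A)].
Qed.

Definition ex_id (A : ex_ob C) : ex_hom regC A A :=
  ExHom (equivalence_relation_idem regC (ex_equiv A))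
    (equivalence_relation_idem regC (ex_equiv A))
    (ex_id_total A) (ex_id_functional A).

Definition ex_comp (A B D : ex_ob C) (T' : ex_hom regC B D)
  (T : ex_hom regC A B) : ex_hom regC A D.
Proof.
apply: (@ExHom C regC A D (ex_graph T' \r ex_graph T)).
- apply: crel_eq_trans (crel_eq_sym (crel_compA _ _ _ _)) _.
  by apply: crel_comp_eq (ex_source T); split; apply: crel_le_refl.
- apply: crel_eq_trans (crel_compA _ _ _ _) _.
  by apply: crel_comp_eq; [apply: ex_target|split; apply: crel_le_refl].
- apply/crel_le_mem => U x x' xx.
  have /mem_crel_comp [V [e [y [re xy /crel_mem_op x'y]]]] :=
    proj1 (crel_le_mem _ _) (ex_total T) _ _ _ xx.
  have yy := equivalence_relation_mem_refl y (ex_equiv B).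
  have /mem_crel_comp [V' [e' [z [re' yz /crel_mem_op y'z]]]] :=
    proj1 (crel_le_mem _ _) (ex_total T') _ _ _ yy.
  apply: (crel_mem_descent re); apply: (crel_mem_descent re').
  apply: (@crel_comp_mem _ _ _ _ _ _ _ _ _ z); last apply/crel_mem_op.
    exact: crel_comp_mem (crel_mem_comp e' xy) yz.
  exact: crel_comp_mem (crel_mem_comp e' x'y) y'z.
- apply/crel_le_mem => U z z' /mem_crel_comp [V [e [x [re]]]].
  move=> /crel_mem_op /mem_crel_comp [V1 [e1 [y [re1 xy yz]]]].
  move=> /(crel_mem_comp e1) /mem_crel_comp [V2 [e2 [y' [re2 xy' yz']]]].
  apply: (crel_mem_descent re); apply: (crel_mem_descent re1).
  apply: (crel_mem_descent re2).
  apply: (proj1 (crel_le_mem _ _) (ex_functional T')).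
  apply: crel_comp_mem yz'; apply/crel_mem_op.
  apply: (proj1 (crel_le_mem _ _) (proj1 (ex_source T'))) => /=.
  have yy : crel_mem (ex_rel B) y' (y \oh e2).
    apply: (proj1 (crel_le_mem _ _) (ex_functional T)).
    apply: (@crel_comp_mem _ _ _ _ _ _ _ _ _ (x \oh e1 \oh e2)).
      exact/crel_mem_op.
    exact: crel_mem_comp.
  exact: crel_comp_mem yy (crel_mem_comp e2 yz).
Defined.

Definition exact_completion : category.
Proof.
apply: (@Category (ex_ob C) (ex_hom regC)
  (fun A B S T => crel_eq (ex_graph S) (ex_graph T)) ex_id ex_comp).
- by move=> A B T; split; apply: crel_le_refl.
- by move=> A B S T; apply: crel_eq_sym.
- by move=> A B S T W; apply: crel_eq_trans.
- by move=> A B D S S' T T'; apply: crel_comp_eq.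
- by move=> A B D E W S T; apply: crel_compA.
- by move=> A B T; exact: (ex_target T).
- by move=> A B T; exact: (ex_source T).
Defined.

End ExactCompletion.

(* A regular functor acts on exact completions by (X, R) |-> (FX, FR) and
   T |-> FT. *)
Section ExactCompletionFunctor.
Variables (C D : category) (regC : regular C) (regD : regular D).
Variables (F : functor C D) (regF : regular_functor F).

Lemma preserves_pullback (X Y Z P : C) (f : hom X Z) (g : hom Y Z)
    (p : hom P X) (q : hom P Y) :
  is_pullback f g p q -> is_pullback (fmap F f) (fmap F g) (fmap F p) (fmap F q).
Proof.
move=> [fg up].
pose c U (fz : hom U Z) (u : hom U X) (v : hom U Y) :
  forall a, hom U (dob (d := cospan f g) a) := fun a : option bool =>
  match a as a0 return hom U (dob (d := cospan f g) a0) with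
  | Some true => u | Some false => v | None => fz end.
have lim : is_limit (D := cospan f g) (c P (f \oh p) p q).
  split; first by case=> /=; [reflexivity|symmetry].
  move=> U u cu.
  have [|w [[pw qw] uw]] := up U (u (Some true)) (u (Some false)).
    by rewrite (cu true) (cu false); reflexivity.
  exists w; split.
    by case=> [[]|] //=; rewrite -comphA pw; apply: (cu true).
  by move=> w' hw'; apply: uw; [apply: (hw' (Some true))|apply: (hw' (Some false))].
have [_ Fup] := regular_functor_limits regF lim.
split; first by rewrite -!fmap_comp; apply: fmap_eqh.
move=> U u v uv.
pose k : forall a, hom U (F (dob (d := cospan f g) a)) := fun a : option bool =>
  match a as a0 return hom U (F (dob (d := cospan f g) a0)) with
  | Some true => u | Some false => v | None => fmap F f \oh u end.
have [|w [pw uw]] := Fup U k.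
  by case=> /=; [reflexivity|symmetry].
exists w; split; first by split; [apply: (pw (Some true))|apply: (pw (Some false))].
move=> w' pw' qw'; apply: uw => -[[]|] //=.
by rewrite fmap_comp -comphA pw'; reflexivity.
Qed.

(* R -> X x Y is a monomorphism if and only if R is the limit of the diagram
   consisting of two copies of the span X <- R -> Y with the same feet. *)
Definition double_span (R X Y : C) (l : hom R X) (r : hom R Y) : diagram C :=
  @Diagram C (bool + bool)%type (bool * bool)%type
    (fun e => inl e.1) (fun e => inr e.2)
    (fun v => match v with inl _ => R | inr b => if b then X else Y end)
    (fun e => match e.2 as b return hom R (if b then X else Y) with
              | true => l | false => r end).

Lemma preserves_jointly_monic (R X Y : C) (l : hom R X) (r : hom R Y) :
  jointly_monic l r -> jointly_monic (fmap F l) (fmap F r).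
Proof.
move=> lr.
pose c : forall a, hom R (dob (d := double_span l r) a) :=
  fun a : bool + bool =>
  match a as a0 return hom R (dob (d := double_span l r) a0) with
  | inl _ => idh R | inr true => l | inr false => r end.
have lim : is_limit (D := double_span l r) c.
  split; first by case=> a [] /=; apply: comph1.
  move=> U u cu; exists (u (inl true)); split.
    case=> [b|[]]; last 2 first.
    - exact: (cu (true, true)).
    - exact: (cu (true, false)).
    rewrite comp1h; apply: lr.
      by rewrite (cu (true, true)) (cu (b, true)); reflexivity.
    by rewrite (cu (true, false)) (cu (b, false)); reflexivity.
  by move=> g hg; rewrite -(hg (inl true)) /= comp1h; reflexivity.
have [_ Fup] := regular_functor_limits regF lim.
move=> U u v hl hr.
pose k : forall a, hom U (F (dob (d := double_span l r) a)) :=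
  fun a : bool + bool =>
  match a as a0 return hom U (F (dob (d := double_span l r) a0)) with
  | inl true => u | inl false => v
  | inr true => fmap F l \oh u | inr false => fmap F r \oh u end.
have [|w [pw _]] := Fup U k.
  by case=> [[] []] /=; try reflexivity; symmetry.
have h1 := pw (inl true); have h2 := pw (inl false).
by rewrite /= fmap_id comp1h in h1 h2; rewrite -h1 -h2; reflexivity.
Qed.

Definition fmap_crel (X Y : C) (R : crel X Y) : crel (F X) (F Y) :=
  CRel (preserves_jointly_monic (crel_monic (c := R))).

Lemma fmap_crel_le (X Y : C) (R S : crel X Y) :
  crel_le R S -> crel_le (fmap_crel R) (fmap_crel S).
Proof.
by move=> [i [il ir]]; exists (fmap F i); split; rewrite -fmap_comp;
  apply: fmap_eqh.
Qed.

Lemma fmap_crel_eq (X Y : C) (R S : crel X Y) :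
  crel_eq R S -> crel_eq (fmap_crel R) (fmap_crel S).
Proof. by move=> [a b]; split; apply: fmap_crel_le. Qed.

Lemma fmap_crel_comp (X Y Z : C) (S : crel Y Z) (R : crel X Y) :
  crel_eq (fmap_crel (crel_comp regC S R))
          (crel_comp regD (fmap_crel S) (fmap_crel R)).
Proof.
have FT : is_composite (fmap_crel S) (fmap_crel R) (fmap_crel (crel_comp regC S R)).
  have [P [p [q [e [pb re el er]]]]] := crel_compP regC S R.
  exists (F P), (fmap F p), (fmap F q), (fmap F e); split => /=.
  - exact: preserves_pullback.
  - exact: regular_functor_epi.
  - by rewrite -!fmap_comp; apply: fmap_eqh.
  - by rewrite -!fmap_comp; apply: fmap_eqh.
split; apply/crel_le_mem => U x z.
  move=> /(mem_composite regD FT) [V [e [y [re xy yz]]]].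
  by apply: (crel_mem_descent re); apply: crel_comp_mem yz.
move=> /mem_crel_comp [V [e [y [re xy yz]]]].
by apply: (crel_mem_descent re); apply: (composite_mem FT) yz.
Qed.

Lemma fmap_crel_op (X Y : C) (R : crel X Y) :
  crel_eq (fmap_crel (crel_op R)) (crel_op (fmap_crel R)).
Proof. by split; exists (idh _); split; apply: comph1. Qed.

Lemma fmap_crel_equiv (X : C) (R : crel X X) :
  equivalence_relation R -> equivalence_relation (fmap_crel R).
Proof.
move=> eR; split.
- have [d [dl dr]] := eqrel_refl eR.
  exists (fmap F d) => /=; rewrite -!fmap_comp -!fmap_id.
  by split; apply: fmap_eqh.
- have [d [dl dr]] := eqrel_sym eR.
  by exists (fmap F d) => /=; rewrite -!fmap_comp; split; apply: fmap_eqh.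
- move=> P p q pb.
  have [Q [p' [q' pb']]] := ex_pullback (regular_limits regC) (crel_r R) (crel_l R).
  have [t [tl tr]] := eqrel_trans eR pb'.
  have [_ Fpb] := preserves_pullback pb'.
  have [w [[wp wq] _]] := Fpb _ p q pb.1.
  exists (fmap F t \oh w) => /=.
  rewrite !comphA -!fmap_comp (fmap_eqh F tl) (fmap_eqh F tr) !fmap_comp -!comphA.
  by rewrite wp wq; split; reflexivity.
Qed.

Definition ex_fmap_ob (A : ex_ob C) : ex_ob D :=
  ExOb (fmap_crel_equiv (ex_equiv A)).

Definition ex_fmap (A B : ex_ob C) (T : ex_hom regC A B) :
  ex_hom regD (ex_fmap_ob A) (ex_fmap_ob B).
Proof.
apply: (@ExHom D regD (ex_fmap_ob A) (ex_fmap_ob B) (fmap_crel (ex_graph T))) => /=.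
- apply: crel_eq_trans (fmap_crel_eq (ex_source T)).
  exact: crel_eq_sym (fmap_crel_comp _ _).
- apply: crel_eq_trans (fmap_crel_eq (ex_target T)).
  exact: crel_eq_sym (fmap_crel_comp _ _).
- apply: crel_le_trans (fmap_crel_le (ex_total T)) _.
  apply: crel_le_trans (fmap_crel_comp _ _).1 _.
  by apply: crel_comp_le; [apply: (fmap_crel_op _).1|apply: crel_le_refl].
- apply: crel_le_trans (fmap_crel_le (ex_functional T)).
  apply: crel_le_trans (fmap_crel_comp _ _).2.
  by apply: crel_comp_le; [apply: crel_le_refl|apply: (fmap_crel_op _).2].
Defined.

Definition exact_completion_functor :
  functor (exact_completion regC) (exact_completion regD).
Proof.
apply: (@Functor (exact_completion regC) (exact_completion regD) ex_fmap_ob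
  (@FunctorOn (exact_completion regC) (exact_completion regD) _ ex_fmap _ _ _)).
- by move=> A B S T; apply: fmap_crel_eq.
- by move=> A; split; apply: crel_le_refl.
- by move=> A B E S T; apply: fmap_crel_comp.
Defined.

End ExactCompletionFunctor.

Local Notation R := Rdefinitions.R.

Definition is_metric (T : Type) (d : T -> T -> R) : Prop :=
  [/\ forall x y, (d x y = 0)%R <-> x = y, forall x y, d x y = d y x
    & forall x y z, (d x z <= d x y + d y z)%R].

Definition metrizes (T : topologicalType) (d : T -> T -> R) : Prop :=
  forall (x : T) (A : set T),
    nbhs x A <-> exists2 e : R, (0 < e)%R & [set y | (d x y < e)%R] `<=` A.

Definition complete_metric (T : topologicalType) (d : T -> T -> R) : Prop :=
  forall u : nat -> T,
    (forall e : R, (0 < e)%R -> exists N, forall m n, (N <= m)%N -> (N <= n)%N ->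
      (d (u m) (u n) < e)%R) ->
    exists x : T, u @ \oo --> x.

Definition completely_metrizable (T : topologicalType) : Prop :=
  exists d : T -> T -> R, [/\ is_metric d, metrizes d & complete_metric d].

Definition separable (T : topologicalType) : Prop :=
  exists2 D : set T, countable D & dense D.

HB.mixin Record isPolishGroup (G : Type) of Group G & Topological G := {
  mulg_continuous : continuous (fun x : G * G => (x.1 * x.2)%g);
  invg_continuous : continuous (fun x : G => (x^-1)%g);
  polish_completely_metrizable : completely_metrizable G;
  polish_separable : separable G
}.

#[short(type="polishGroupType")]
HB.structure Definition PolishGroup :=
  {G of Group G & Topological G & isPolishGroup G}.

Section ProductPolishGroup.
Variables G H : polishGroupType.
Local Notation GH := (G * H)%type.

Lemma prod_mulg_continuous : continuous (fun x : GH * GH => (x.1 * x.2)%g).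
Proof.
move=> x; apply: cvg_pair.
  apply: (@continuous_comp _ _ _ (fun x : GH * GH => (x.1.1, x.2.1))
    (fun z : G * G => (z.1 * z.2)%g)); last exact: mulg_continuous.
  apply: cvg_pair.
    by apply: (@continuous_comp _ _ _ fst fst); apply: cvg_fst.
  by apply: (@continuous_comp _ _ _ snd fst); [apply: cvg_snd|apply: cvg_fst].
apply: (@continuous_comp _ _ _ (fun x : GH * GH => (x.1.2, x.2.2))
  (fun z : H * H => (z.1 * z.2)%g)); last exact: mulg_continuous.
apply: cvg_pair.
  by apply: (@continuous_comp _ _ _ fst snd); [apply: cvg_fst|apply: cvg_snd].
by apply: (@continuous_comp _ _ _ snd snd); apply: cvg_snd.
Qed.

Lemma prod_invg_continuous : continuous (fun x : GH => (x^-1)%g).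
Proof.
move=> x; apply: cvg_pair.
  by apply: (@continuous_comp _ _ _ fst (fun z : G => (z^-1)%g));
    [apply: cvg_fst|apply: invg_continuous].
by apply: (@continuous_comp _ _ _ snd (fun z : H => (z^-1)%g));
  [apply: cvg_snd|apply: invg_continuous].
Qed.

Lemma prod_completely_metrizable : completely_metrizable GH.
Proof.
have [d1 [[d10 d1s d1t] m1 c1]] := @polish_completely_metrizable G.
have [d2 [[d20 d2s d2t] m2 c2]] := @polish_completely_metrizable H.
pose d (x y : GH) := Num.max (d1 x.1 y.1) (d2 x.2 y.2).
have ge0 (T : Type) (r : T -> T -> R) : (forall x y, (r x y = 0)%R <-> x = y) ->
    (forall x y, r x y = r y x) ->
    (forall x y z, (r x z <= r x y + r y z)%R) ->
    forall x y, (0 <= r x y)%R.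
  move=> r0 rs rt x y; have := rt x y x; rewrite (proj2 (r0 x x) erefl).
  by rewrite (rs y x) -mulr2n pmulrn_lge0.
have d1ge := ge0 _ _ d10 d1s d1t; have d2ge := ge0 _ _ d20 d2s d2t.
exists d; split; first split.
- move=> [a b] [a' b']; split.
    rewrite /d /= => h; congr pair.
      by apply/d10/eqP; rewrite eq_le d1ge andbT -h le_max lexx.
    by apply/d20/eqP; rewrite eq_le d2ge andbT -h le_max lexx orbT.
  move=> [-> ->]; rewrite /d /= (proj2 (d10 _ _) erefl) (proj2 (d20 _ _) erefl).
  by rewrite maxxx.
- by move=> x y; rewrite /d d1s d2s.
- move=> x y z; rewrite /d ge_max; apply/andP; split.
    by apply: le_trans (d1t _ y.1 _) _; apply: lerD; rewrite le_max lexx.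
  by apply: le_trans (d2t _ y.2 _) _; apply: lerD; rewrite le_max lexx orbT.
- move=> x A; split.
    move=> [[B1 B2] /= [/m1 [e1 e10 h1] /m2 [e2 e20 h2]] BA].
    exists (Num.min e1 e2); first by rewrite lt_min e10.
    move=> y; rewrite /d /= gt_max !lt_min => /andP[/andP[y1 _] /andP[_ y2]].
    by apply: BA; split; [apply: h1|apply: h2].
  move=> [e e0 h]; exists ([set y | (d1 x.1 y < e)%R], [set y | (d2 x.2 y < e)%R]).
    by split; [apply/m1|apply/m2]; exists e.
  by move=> y [/= y1 y2]; apply: h; rewrite /d /= gt_max y1.
- move=> u cu.
  have [|a ua] := c1 (fun n => (u n).1).
    move=> e /cu [N hN]; exists N => m n Nm Nn.
    by apply: le_lt_trans (hN _ _ Nm Nn); rewrite le_max lexx.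
  have [|b ub] := c2 (fun n => (u n).2).
    move=> e /cu [N hN]; exists N => m n Nm Nn.
    by apply: le_lt_trans (hN _ _ Nm Nn); rewrite le_max lexx orbT.
  exists (a, b).
  have -> : u = (fun n => ((u n).1, (u n).2)) by apply/funext => n; case: (u n).
  exact: cvg_pair.
Qed.

Lemma prod_separable : separable GH.
Proof.
have [D1 cD1 dD1] := @polish_separable G.
have [D2 cD2 dD2] := @polish_separable H.
exists (D1 `*` D2); first exact: countableX.
move=> O [x Ox] oO.
have : nbhs x O by apply: open_nbhs_nbhs.
move=> [[A B] /= [/nbhs_interior A1 /nbhs_interior B1] ABO].
have [|a [Aa Da]] := dD1 A° _ (@open_interior _ A).
  by exists x.1; apply: nbhs_singleton.
have [|b [Bb Db]] := dD2 B° _ (@open_interior _ B).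
  by exists x.2; apply: nbhs_singleton.
by exists (a, b); split => //; apply: ABO; split; apply: interior_subset.
Qed.

HB.instance Definition _ := isPolishGroup.Build GH prod_mulg_continuous
  prod_invg_continuous prod_completely_metrizable prod_separable.

End ProductPolishGroup.

Record polish_hom (G H : polishGroupType) := PolishHom {
  polish_fun :> G -> H;
  polish_homM : {morph polish_fun : x y / (x * y)%g};
  polish_hom_continuous : continuous polish_fun
}.

Lemma comp_homM (G H K : groupType) (g : H -> K) (f : G -> H) :
  {morph g : x y / (x * y)%g} -> {morph f : x y / (x * y)%g} ->
  {morph g \o f : x y / (x * y)%g}.
Proof. by move=> gM fM x y /=; rewrite fM gM. Qed.

Definition polish_id (G : polishGroupType) : polish_hom G G :=
  @PolishHom G G id (fun _ _ => erefl) (fun x => cvg_id).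

Definition polish_comp (G H K : polishGroupType) (g : polish_hom H K)
    (f : polish_hom G H) : polish_hom G K :=
  @PolishHom G K (g \o f) (comp_homM (@polish_homM _ _ g) (@polish_homM _ _ f))
    (fun x => @continuous_comp _ _ _ f g x (@polish_hom_continuous _ _ f x)
      (@polish_hom_continuous _ _ g (f x))).

Definition polish_cat : category.
Proof.
apply: (@Category polishGroupType polish_hom (fun G H f g => f =1 g)
  polish_id polish_comp) => //=.
- by move=> G H f g fg x; rewrite fg.
- by move=> G H f g h fg gh x; rewrite fg gh.
- by move=> G H K g g' f f' gg ff x /=; rewrite ff gg.
Defined.

Definition is_subgroup (G : groupType) (N : set G) : Prop :=
  [/\ N 1%g, forall x y, N x -> N y -> N (x * y)%g & forall x, N x -> N (x^-1)%g].

(* A Polish group topology on the subgroup A for which A -> G is continuous,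
   presented as a Polish group K with a continuous injective homomorphism i onto
   A, along which the topology of K is transported to A. *)
Definition polish_topology (G : polishGroupType) (A : set G)
    (K : polishGroupType) (i : polish_hom K G) : Prop :=
  injective i /\ range i = A.

Definition is_polish_subgroup (G : polishGroupType) (A : set G) : Prop :=
  is_subgroup A /\ exists (K : polishGroupType) (i : polish_hom K G),
    polish_topology A i.

(* The pair (G, N) of a group with a Polish cover G/N. *)
Record normal_polish_subgroup (G : polishGroupType) := NormalPolishSubgroup {
  nps_set : set G;
  nps_polish : is_polish_subgroup nps_set;
  nps_normal : forall x g, nps_set x -> nps_set (g^-1 * x * g)%g
}.

Record polish_cover := PolishCover {
  cover_group : polishGroupType;
  cover_sub : normal_polish_subgroup cover_group
}.

Section CoverQuotient.
Variable A : polish_cover.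
Local Notation G := (cover_group A).
Local Notation N := (nps_set (cover_sub A)).
Local Open Scope quotient_scope.
Local Open Scope group_scope.

Definition coset_eqv (x y : G) : bool := `[< N (x^-1 * y) >].

Lemma coset_eqvP (x y : G) : reflect (N (x^-1 * y)) (coset_eqv x y).
Proof. exact: asboolP. Qed.

Lemma coset_eqv_refl : reflexive coset_eqv.
Proof.
by move=> x; apply/coset_eqvP; rewrite mulVg; have [[]] := nps_polish (cover_sub A).
Qed.

Lemma coset_eqv_sym : symmetric coset_eqv.
Proof.
have [[_ _ NV] _] := nps_polish (cover_sub A).
by move=> x y; apply/coset_eqvP/coset_eqvP => /NV; rewrite invgM invgK.
Qed.

Lemma coset_eqv_trans : transitive coset_eqv.
Proof.
have [[_ NM _] _] := nps_polish (cover_sub A).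
move=> y x z /coset_eqvP xy /coset_eqvP yz; apply/coset_eqvP.
by have := NM _ _ xy yz; rewrite mulgA mulgK.
Qed.

Canonical coset_equiv := EquivRel coset_eqv coset_eqv_refl coset_eqv_sym
  coset_eqv_trans.

Definition cover_quotient := {eq_quot coset_equiv}.
HB.instance Definition _ := Choice.on cover_quotient.
HB.instance Definition _ := Quotient.on cover_quotient.

Definition coset (g : G) : cover_quotient := \pi g.

Lemma coset_eqP (x y : G) : coset x = coset y <-> N (x^-1 * y).
Proof.
split=> [/eqP|/coset_eqvP xy]; last by apply/eqP; rewrite /coset piE.
by rewrite /coset piE => /coset_eqvP.
Qed.

Lemma coset_surj (q : cover_quotient) : exists g, coset g = q.
Proof. by exists (repr q); apply: reprK. Qed.

Definition quotient_one : cover_quotient := coset 1.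
Definition quotient_mul (p q : cover_quotient) : cover_quotient :=
  coset (repr p * repr q).
Definition quotient_inv (p : cover_quotient) : cover_quotient :=
  coset (repr p)^-1.

Lemma quotient_mulE (x y : G) :
  quotient_mul (coset x) (coset y) = coset (x * y).
Proof.
have [[_ NM _] _] := nps_polish (cover_sub A).
apply/coset_eqP; set x' := repr _; set y' := repr _.
have /coset_eqP hx : coset x' = coset x by apply: reprK.
have /coset_eqP hy : coset y' = coset y by apply: reprK.
have := NM _ _ (nps_normal y' hx) hy.
by rewrite invgM !mulgA mulgK.
Qed.

Lemma quotient_invE (x : G) : quotient_inv (coset x) = coset x^-1.
Proof.
have [[_ NM NV] _] := nps_polish (cover_sub A).
apply/coset_eqP; set x' := repr _.
have /coset_eqP hx : coset x' = coset x by apply: reprK.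
have := nps_normal x'^-1 (NV _ hx).
by rewrite invgM !invgK !mulgA mulgK.
Qed.

Lemma quotient_mulA : associative quotient_mul.
Proof.
move=> p q r; have [x <-] := coset_surj p; have [y <-] := coset_surj q.
by have [z <-] := coset_surj r; rewrite !quotient_mulE mulgA.
Qed.

Lemma quotient_mul1 : left_id quotient_one quotient_mul.
Proof.
by move=> p; have [x <-] := coset_surj p; rewrite quotient_mulE mul1g.
Qed.

Lemma quotient_1mul : right_id quotient_one quotient_mul.
Proof.
by move=> p; have [x <-] := coset_surj p; rewrite quotient_mulE mulg1.
Qed.

Lemma quotient_mulV : left_inverse quotient_one quotient_inv quotient_mul.
Proof.
move=> p; have [x <-] := coset_surj p.
by rewrite quotient_invE quotient_mulE mulVg.
Qed.

Lemma quotient_Vmul : right_inverse quotient_one quotient_inv quotient_mul.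
Proof.
move=> p; have [x <-] := coset_surj p.
by rewrite quotient_invE quotient_mulE mulgV.
Qed.

HB.instance Definition _ := isGroup.Build cover_quotient quotient_mulA
  quotient_mul1 quotient_1mul quotient_mulV quotient_Vmul.

End CoverQuotient.
Arguments coset {A} g.

Definition borel_function (T U : topologicalType) (f : T -> U) : Prop :=
  forall B : set U, <<s @open U >> B -> <<s @open T >> (f @^-1` B).

Definition borel_definable (A B : polish_cover)
    (f : cover_quotient A -> cover_quotient B) : Prop :=
  exists2 phi : cover_group A -> cover_group B,
    borel_function phi & forall g, f (coset g) = coset (phi g).

Record cover_hom (A B : polish_cover) := CoverHom {
  cover_fun :> cover_quotient A -> cover_quotient B;
  cover_homM : {morph cover_fun : x y / (x * y)%g};
  cover_hom_borel : borel_definable cover_fun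
}.

Lemma borel_definable_id (A : polish_cover) : borel_definable (@id (cover_quotient A)).
Proof. by exists id. Qed.

Lemma borel_definable_comp (A B D : polish_cover)
    (g : cover_quotient B -> cover_quotient D)
    (f : cover_quotient A -> cover_quotient B) :
  borel_definable g -> borel_definable f -> borel_definable (g \o f).
Proof.
move=> [psi bpsi gE] [phi bphi fE]; exists (psi \o phi).
  by move=> B' /bpsi /bphi.
by move=> x /=; rewrite fE gE.
Qed.

Definition cover_id (A : polish_cover) : cover_hom A A :=
  @CoverHom A A id (fun _ _ => erefl) (borel_definable_id A).

Definition cover_comp (A B D : polish_cover) (g : cover_hom B D)
    (f : cover_hom A B) : cover_hom A D :=
  @CoverHom A D (g \o f) (comp_homM (@cover_homM _ _ g) (@cover_homM _ _ f))
    (borel_definable_comp (cover_hom_borel g) (cover_hom_borel f)).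

Definition cover_cat : category.
Proof.
apply: (@Category polish_cover cover_hom (fun A B f g => f =1 g)
  cover_id cover_comp) => //=.
- by move=> A B f g fg x; rewrite fg.
- by move=> A B f g h fg gh x; rewrite fg gh.
- by move=> A B D g g' f f' gg ff x /=; rewrite ff gg.
Defined.

Definition coset_relation (A : polish_cover) :
    set (cover_group A * cover_group A) :=
  [set x | coset x.1 = coset x.2].

Definition lifted_graph (A B : polish_cover)
    (f : cover_quotient A -> cover_quotient B) :
    set (cover_group A * cover_group B) :=
  [set x | f (coset x.1) = coset x.2].

Section SGroups.
Variable S : polish_cat -> Prop.

Definition in_upto_iso (K : polish_cat) : Prop :=
  exists2 L : polish_cat, S L & isomorphic K L.

(* A, with its Polish group topology as a Polish subgroup of G, is isomorphic to
   an object of S. *)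
Definition polish_subgroup_in (G : polishGroupType) (A : set G) : Prop :=
  exists (K : polishGroupType) (i : polish_hom K G),
    polish_topology A i /\ in_upto_iso K.

Definition S_cover (A : cover_cat) : Prop :=
  in_upto_iso (cover_group A) /\ polish_subgroup_in (@coset_relation A).

Definition S_definable (A B : cover_cat) (f : hom A B) : Prop :=
  polish_subgroup_in (lifted_graph (cover_fun f)).

End SGroups.

(* The canonical functor Ex(P) -> PC: it sends (G, E_N^G) to G/N and T to the
   homomorphism gN |-> hM for (g, h) in T.  These conditions determine the
   subgroups N and the homomorphisms. *)
Definition graph_of (G H : polish_cat) (T : crel G H) : set (G * H) :=
  [set x | exists t : (crel_ob T : polishGroupType),
     polish_fun (crel_l T) t = x.1 /\ polish_fun (crel_r T) t = x.2].

Definition canon_cover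
    (N : forall X : ex_ob polish_cat, normal_polish_subgroup (ex_carrier X))
    (X : ex_ob polish_cat) : polish_cover := PolishCover (N X).

Record canonical_functor (regP : regular polish_cat) := CanonicalFunctor {
  canon_sub : forall X : ex_ob polish_cat,
    normal_polish_subgroup (ex_carrier X);
  canon_subE : forall X : ex_ob polish_cat,
    graph_of (ex_rel X) = @coset_relation (canon_cover canon_sub X);
  canon_fon : @functor_on (exact_completion regP) cover_cat
    (canon_cover canon_sub);
  canon_homE : forall (X Y : ex_ob polish_cat) (T : ex_hom regP X Y)
      (g : (ex_carrier X : polishGroupType))
      (h : (ex_carrier Y : polishGroupType)),
    graph_of (ex_graph T) (g, h) ->
    cover_fun (fmap_of canon_fon T) (@coset (canon_cover canon_sub X) g) =
    @coset (canon_cover canon_sub Y) h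
}.

Definition canonical (regP : regular polish_cat) (Phi : canonical_functor regP) :
  functor (exact_completion regP) cover_cat := Functor (canon_fon Phi).

(* Main.v *)
From HB Require Import structures.
From mathcomp Require Import all_boot all_order all_algebra.
From mathcomp Require Import all_classical all_reals.
From mathcomp Require Import topology.
From mathcomp Require Import measurable_structure.
From mathcomp Require Import Rstruct.
From mathcomp Require Import lra.
Require Import Defs.

(* The objects and morphisms of Ex(P) are read off from their sets of points.
   This rests on three facts about Polish groups: a surjective continuous
   homomorphism is open, it has a Borel section, and the image of any continuous
   homomorphism is Polish for the quotient topology.  They make P
   regular, with the surjections as regular epimorphisms, and show that a relation
   in P is determined by its graph, that relations compose as graphs, and that a
   morphism T of Ex(P) induces a Borel-definable homomorphism whose lifted graph
   is the graph of T.  Since S is closed in P under finite limits and regular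
   images, the relations in S are exactly the relations whose graph is isomorphic
   to an object of S.  Hence the restriction of the canonical functor to Ex(S) is
   faithful, its morphisms are exactly the S-definable homomorphisms, and every
   S-group with a Polish cover is reached by transporting its coset relation
   along an isomorphism of the covering group with an object of S. *)

Set Implicit Arguments.
Unset Strict Implicit.
Unset Printing Implicit Defensive.
Import Order.TTheory GRing.Theory Num.Theory.
Local Open Scope classical_set_scope.
Local Notation R := Rdefinitions.R.

(** * Sieves on complete separable metric spaces *)

(** A Polish group need not have a complete left-invariant metric, so no single metric serves both
    completeness and translations. Baire category, the open mapping theorem, Borel sections and
    completeness of images are therefore all run on sieves, where convergence is a matter of nested
    open sets. The delicate point is the image of a homomorphism: its quotient topology must be
    shown completely metrizable, and Cauchy sequences for a one-sided uniformity may diverge, whence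
    the two-sided uniformity. Openness of surjections lets points control arrows: a set-theoretic
    factorization through a surjection is automatically continuous, so an inclusion of graphs lifts
    to an arrow between relations. On the side of [S], membership is only up to isomorphism. Lifted
    graphs are first moved to objects of [S], handled there as internal relations, and moved back.
    Since the target subcategory need not be full, essential surjectivity asks for an isomorphism
    that is definable in both directions. *)

Section Metric.
Variables (T : topologicalType) (d : T -> T -> R).
Hypotheses (dm : is_metric d) (dT : metrizes d).
Local Open Scope ring_scope.

Lemma metric_self x : d x x = 0.
Proof. by have [d0 _ _] := dm; apply/d0. Qed.

Lemma metric_ge0 x y : 0 <= d x y.
Proof.
have [_ ds dt] := dm; have := dt x y x; rewrite metric_self (ds y x) -mulr2n.
by rewrite pmulrn_lge0.
Qed.

Lemma nbhs_metric_ball x e : 0 < e -> nbhs x [set y | d x y < e].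
Proof. by move=> e0; apply/dT; exists e. Qed.

Lemma open_metric_ball x e : open [set y | d x y < e].
Proof.
rewrite openE => y /= xy; apply/dT; exists (e - d x y); first by rewrite subr_gt0.
have [_ _ dt] := dm.
by move=> z /= yz; apply: le_lt_trans (dt _ y _) _; rewrite -ltrBrDl.
Qed.

Lemma closure_metric_le x e (A : set T) :
  (forall y, A y -> d x y <= e) -> forall y, closure A y -> d x y <= e.
Proof.
move=> Ae y cAy; have [_ ds dt] := dm; apply/ler_addgt0Pr => a a0.
have [z [/Ae xz /= yz]] := cAy _ (nbhs_metric_ball y a0).
by apply: le_trans (dt _ z _) _; rewrite (ds z y); apply: lerD => //; apply: ltW.
Qed.

Lemma metric_nbhs_eq (x y : T) : (forall A, nbhs x A -> A y) -> x = y.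
Proof.
move=> xy; have [d0 _ _] := dm; apply/d0; apply: le_anti.
rewrite metric_ge0 andbT; apply/ler_addgt0Pr => e e0; rewrite add0r ltW //.
exact: xy (nbhs_metric_ball x e0).
Qed.

Lemma metric_cvg (u : nat -> T) x : (forall e, 0 < e ->
  exists N, forall n, (N <= n)%N -> d x (u n) < e) -> u @ \oo --> x.
Proof.
move=> h A /dT [e /h [N hN] eA]; exists N => //= n /= Nn.
by apply: eA; apply: hN.
Qed.

Lemma cvg_metric (u : nat -> T) x e : u @ \oo --> x -> 0 < e ->
  exists N, forall n, (N <= n)%N -> d x (u n) < e.
Proof.
move=> ux e0; have [N _ hN] := ux _ (nbhs_metric_ball x e0).
by exists N => n Nn; apply: hN.
Qed.

Lemma metric_separableP : separable T <->
  exists2 D : set T, countable D & forall x e, 0 < e -> exists2 y, D y & d x y < e.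
Proof.
split=> -[D cD DD]; exists D => //.
  move=> x e e0; have [|y [/= xy Dy]] := DD _ _ (open_metric_ball x e).
    by exists x; rewrite /= metric_self.
  by exists y.
move=> O [x Ox] oO; have /dT [e e0 eO] : nbhs x O by apply: open_nbhs_nbhs.
by have [y Dy xy] := DD x _ e0; exists y; split => //; apply: eO.
Qed.

End Metric.

(** Covering [D] instead of equalling it allows a finite or empty [D]; spare indices return [x0]. *)
Lemma countable_enum (T : choiceType) (D : set T) (x0 : T) : countable D ->
  exists e : nat -> T, D `<=` range e.
Proof.
move=> /countable_injP [f fi].
exists (fun n => xget x0 [set x | D x /\ f x = n]) => x Dx.
exists (f x) => //; case: xgetP => [y _ [Dy fy]|/(_ x)]; last by case.
by apply: fi => //; rewrite inE.
Qed.

(* A countable base refined by a relation: descending chains along [sieve_fine]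
   shrink to a point, which replaces convergence of Cauchy sequences. *)
Record sieve (T : topologicalType) := Sieve {
  sieve_set :> nat -> set T;
  sieve_fine : nat -> nat -> nat -> Prop;
  sieve_open : forall i, open (sieve_set i);
  sieve_base : forall x A, nbhs x A ->
    exists2 i, sieve_set i x & sieve_set i `<=` A;
  sieve_refine : forall n j x A, sieve_set j x -> nbhs x A ->
    exists i, [/\ sieve_fine n j i, sieve_set i x & sieve_set i `<=` A];
  sieve_shrink : forall s : nat -> nat,
    (forall n, sieve_fine n (s n) (s n.+1)) ->
    (forall n, sieve_set (s n) !=set0) ->
    exists x, (forall n, sieve_set (s n) x) /\
      forall A, nbhs x A -> exists n, sieve_set (s n) `<=` A
}.


Lemma sieve_exists (T : topologicalType) (x0 : T) : completely_metrizable T ->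
  separable T -> inhabited (sieve T).
Proof.
move=> [d [dm dT dc]] /(metric_separableP dm dT) [D cD dD].
have [_ ds dt] := dm.
have [e De] := countable_enum x0 cD.
pose r (k : nat) : R := (k.+1%:R^-1)%R.
have r0 k : (0 < r k)%R by rewrite invr_gt0 ltr0n.
have rsmall (a : R) : (0 < a)%R -> exists k, (r k < a)%R.
  by move=> a0; have [k] := ltr_add_invr a0; rewrite add0r; exists k.
(* A number that codes no pair gives the empty set, which is harmless because [sieve_shrink] only
   concerns chains of nonempty sets. *)
pose B i := match unpickle i : option (nat * nat) with
  | Some p => [set y | (d (e p.1) y < r p.2)%R] | None => set0 end.
(* Small diameters make a chain Cauchy; nesting of closures keeps the limit inside every member. *)
pose fine (n j i : nat) := closure (B i) `<=` B j /\
  forall x y, B i x -> B i y -> (d x y < r n)%R.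
have small (x : T) (a : R) : (0 < a)%R -> exists i, [/\ B i x,
    closure (B i) `<=` [set y | (d x y < a)%R] &
    forall y z, B i y -> B i z -> (d y z < a)%R].
  (* A centre within [r k] of [x] and a radius [r k] add up to [r k + r k], hence the half. *)
  move=> a0; have [|k ka] := rsmall (a / 2)%R; first by rewrite divr_gt0.
  have {}ka : (r k + r k < a)%R by rewrite [a in ltRHS]splitr ltrD.
  have [_ /De [n _ <-] xn] := dD x _ (r0 k).
  exists (pickle (n, k)); rewrite /B pickleK /=; split; first by rewrite ds.
    move=> y /(closure_metric_le dm dT (x := e n) (e := r k)) h /=.
    have := h (fun z zk => ltW zk) => {}h.
    have := dt x (e n) y; lra.
  move=> y z yk zk; have := dt y (e n) z; rewrite (ds y (e n)); lra.
split; apply: (@Sieve T B fine).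
- move=> i; rewrite /B; case: unpickle => [p|]; last exact: open0.
  exact: open_metric_ball.
- move=> x A /dT [a a0 aA]; have [i [Bx cB _]] := small x a a0; exists i => //.
  by move=> y /subset_closure /cB /aA.
- move=> n j x A Bj /dT [a a0 aA].
  have /dT [b b0 bB] : nbhs x (B j).
    apply: open_nbhs_nbhs; split=> //; rewrite /B; case: unpickle => [p|].
      exact: open_metric_ball.
    exact: open0.
  have [|i [Bx cB dB]] := small x (Num.min a (Num.min b (r n))).
    by rewrite !lt_min a0 b0 r0.
  exists i; split=> //.
    split=> [y /cB /=|y z By Bz]; first by rewrite !lt_min => /and3P[_ /bB].
    by have := dB _ _ By Bz; rewrite !lt_min => /and3P[].
  by move=> y /subset_closure /cB /=; rewrite lt_min => /andP[/aA].
- move=> s sf sne; have [u Bu] := choice sne.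
  have mono m n : (m <= n)%N -> B (s n) `<=` B (s m).
    move=> mn; rewrite -(subnKC mn); elim: (n - m)%N => [|k IH]; rewrite ?addn0 //.
    by rewrite addnS => y /subset_closure /(proj1 (sf _)) /IH.
  (* Stage [n] bounds the diameter of the set at [n.+1], hence the strict [n < m]. *)
  have close n m y z : (n < m)%N -> B (s m) y -> B (s n.+1) z -> (d y z < r n)%R.
    by move=> nm /(mono _ _ nm) By Bz; apply: (proj2 (sf n)).
  have [|x ux] := dc u.
    move=> a /rsmall [k ka]; exists k.+1 => m n km kn; apply: lt_trans ka.
    exact: close km (Bu m) (mono _ _ kn _ (Bu n)).
  have clx n : closure (B (s n)) x.
    move=> A /ux [N _ hN]; exists (u (maxn N n)); split; last first.
      by apply: hN => /=; exact: leq_maxl.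
    exact: mono (leq_maxr N n) _ (Bu _).
  have Bx n : B (s n) x by apply: (proj1 (sf n)).
  exists x; split=> // A /dT [a /rsmall [k ka] aA].
  exists k.+1 => y By; apply: aA; apply: lt_trans ka.
  exact: (close k k.+1).
Qed.

Lemma completely_metrizable_nbhs_eq (T : topologicalType) (x y : T) :
  completely_metrizable T -> (forall A, nbhs x A -> A y) -> x = y.
Proof. by move=> [d [dm dT _]]; apply: (metric_nbhs_eq dm dT). Qed.

(** The Hausdorff property in the form used below, where almost openness only places [y] in
    closures. *)
Lemma completely_metrizable_closure (T : topologicalType) (x y : T) :
  completely_metrizable T -> (forall A, nbhs x A -> closure A y) -> x = y.
Proof.
move=> cm xy; have [d [dm dT _]] := cm.
apply: (metric_nbhs_eq dm dT) => A /dT [e e0 eA].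
have e20 : (0 < e / 2)%R by rewrite divr_gt0.
apply: eA => /=; apply: (@le_lt_trans _ _ (e / 2)%R).
  apply: (closure_metric_le dm dT _ (xy _ (nbhs_metric_ball dT x e20))) => z.
  exact: ltW.
by rewrite ltr_pdivrMr // mulr_natr mulr2n ltrDl.
Qed.


(** The stage number is stored beside the value and the invariant in a subset type, which reduces a
    step that depends on the stage to plain dependent choice. *)
Lemma dependent_choice_nat (T : Type) (P : nat -> T -> Prop)
    (Q : nat -> T -> T -> Prop) (x0 : T) : P 0%N x0 ->
  (forall n x, P n x -> exists2 y, Q n x y & P n.+1 y) ->
  exists2 s : nat -> T, s 0%N = x0 & forall n, P n (s n) /\ Q n (s n) (s n.+1).
Proof.
move=> P0 PQ; pose St := {p : nat * T | P p.1 p.2}.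
have step (p : St) :
    {q : St | (sval q).1 = (sval p).1.+1 /\ Q (sval p).1 (sval p).2 (sval q).2}.
  apply: cid; case: p => -[n x] /= Px; have [y Qy Py] := PQ n x Px.
  by exists (exist _ (n.+1, y) Py).
have [u [u0 us]] := dependent_choice step (exist _ (0%N, x0) P0).
have u1 n : (sval (u n)).1 = n.
  by elim: n => [|n IH]; [rewrite u0|rewrite (us n).1 IH].
exists (fun n => (sval (u n)).2) => [|n]; first by rewrite u0.
have := (us n).2; rewrite (u1 n) => Qn; split=> //.
by have := svalP (u n); rewrite (u1 n).
Qed.

(** A chain starting inside [O] enters the [n]-th dense open set at stage [n]; its common point lies
    in all of them. A countable index type admits families indexed by pairs without renumbering. *)
Theorem sieve_baire (T : topologicalType) (B : sieve T) (I : countType)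
    (U : I -> set T) : (forall i, open (U i)) -> (forall i, dense (U i)) ->
  dense (\bigcap_i U i).
Proof.
move=> oU dU O [x Ox] oO.
pose V n := if unpickle n is Some i then U i else setT.
have oV n : open (V n) by rewrite /V; case: unpickle => // ; exact: openT.
have dV n : dense (V n).
  by rewrite /V; case: unpickle => // W [y Wy] _; exists y.
have [i0 Bi0 BO] := sieve_base B (open_nbhs_nbhs (conj oO Ox)).
have [|n j [y Bj]|s s0 sP] := @dependent_choice_nat nat
  (fun n j => B j !=set0)
  (fun n j i => sieve_fine B n j i /\ B i `<=` V n) i0; first by exists x.
  have [z [Bz Vz]] := dV n (B j) (ex_intro _ y Bj) (sieve_open B j).
  have [i [f Bi iV]] := sieve_refine n Bz (open_nbhs_nbhs (conj (oV n) Vz)).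
  by exists i => //; exists z.
have [z [zs _]] := sieve_shrink (fun n => (sP n).2.1) (fun n => (sP n).1).
exists z; split; first by apply: BO; rewrite -s0.
by move=> i _; have := (sP (pickle i)).2.2 z (zs _); rewrite /V pickleK.
Qed.

Lemma sieve_closed_cover (T : topologicalType) (B : sieve T) (x0 : T)
    (F : nat -> set T) : (forall n, closed (F n)) -> (forall x, exists n, F n x) ->
  exists n, (F n)° !=set0.
Proof.
move=> cF covF; apply: contrapT => Fi.
have [n O [x Ox] oO|x [_ Fx]] := @sieve_baire T B nat (fun n => ~` F n)
  (fun n => closed_openC (cF n)) _ setT (ex_intro _ x0 I) openT.
  apply: contrapT => OF; apply: Fi; exists n; exists x.
  apply: filterS (open_nbhs_nbhs (conj oO Ox)) => y Oy.
  by apply: contrapT => Fy; apply: OF; exists y.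
by have [n Fnx] := covF x; apply: (Fx n).
Qed.

(** Density of [D] relative to [A] becomes density in the whole space, as Baire requires; at points
    of [A] the added complement changes nothing. *)
Lemma dense_setUCclosure (T : topologicalType) (A D : set T) :
  (forall O, open O -> O `&` A !=set0 -> O `&` D !=set0) ->
  dense (D `|` ~` closure A).
Proof.
move=> AD O [x Ox] oO.
have [/(AD _ oO)[y [Oy Dy]]|OA] := pselect (O `&` A !=set0).
  by exists y; split=> //; left.
exists x; split=> //; right => /(_ O (open_nbhs_nbhs (conj oO Ox))) [y [Ay Oy]].
by apply: OA; exists y.
Qed.

Lemma closure_image_continuous (T U : topologicalType) (f : T -> U) (A : set T)
  (x : T) : continuous f -> closure A x -> closure (f @` A) (f x).
Proof.
by move=> cf cA W /cf /cA [y [Ay Wy]]; exists (f y); split => //; exists y.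
Qed.

Lemma nbhs_op2 (T U V : topologicalType) (m : T * U -> V) (x : T) (y : U)
    (A : set V) : continuous m -> nbhs (m (x, y)) A ->
  exists2 B, nbhs x B & exists2 C, nbhs y C &
    forall b c, B b -> C c -> A (m (b, c)).
Proof.
move=> mc /mc [[B C] /= [nB nC] BC]; exists B => //; exists C => // b c Bb Cc.
exact: (BC (b, c)).
Qed.

(** * The open mapping theorem for Polish groups *)

Section PolishGroupTopology.
Variable G : polishGroupType.
Local Open Scope group_scope.

Lemma polish_sieve : inhabited (sieve G).
Proof.
exact: sieve_exists 1%g polish_completely_metrizable polish_separable.
Qed.

Lemma polish_nbhs_mul (x y : G) (A : set G) : nbhs (x * y) A ->
  exists2 B, nbhs x B & exists2 C, nbhs y C & forall b c, B b -> C c -> A (b * c).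
Proof. exact: nbhs_op2 (@mulg_continuous G). Qed.

Lemma mulgl_continuous (x : G) : continuous (fun y : G => x * y).
Proof.
move=> y A /polish_nbhs_mul [B /nbhs_singleton Bx [C nC BC]].
by apply: filterS nC => z; apply: BC.
Qed.

Lemma mulgr_continuous (x : G) : continuous (fun y : G => y * x).
Proof.
move=> y A /polish_nbhs_mul [B nB [C /nbhs_singleton Cx BC]].
by apply: filterS nB => z Bz; apply: BC.
Qed.

Lemma nbhs1_divl (A : set G) : nbhs 1 A ->
  exists2 V, nbhs 1 V & forall x y, V x -> V y -> A (x^-1 * y).
Proof.
move=> nA; have [|B nB [C nC BC]] := @polish_nbhs_mul 1 1 A.
  by rewrite mulg1.
exists ([set x | B x^-1] `&` C); last by move=> x y [/= Bx _] [_]; apply: BC.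
by apply: filterI => //; apply: (@invg_continuous G 1 B); rewrite invg1.
Qed.

Lemma nbhs1_divr (A : set G) : nbhs 1 A ->
  exists2 V, nbhs 1 V & forall x y, V x -> V y -> A (x * y^-1).
Proof.
move=> nA; have [|B nB [C nC BC]] := @polish_nbhs_mul 1 1 A.
  by rewrite mulg1.
exists (B `&` [set x | C x^-1]); last by move=> x y [Bx _] [_]; apply: BC.
by apply: filterI => //; apply: (@invg_continuous G 1 C); rewrite invg1.
Qed.

Lemma nbhs_translate (x : G) (A : set G) :
  nbhs x A -> nbhs 1 [set y | A (x * y)].
Proof. by move=> nA; apply: (@mulgl_continuous x 1 A); rewrite mulg1. Qed.

Lemma nbhs1_translate (x : G) (A : set G) :
  nbhs 1 A -> nbhs x [set y | A (x^-1 * y)].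
Proof. by move=> nA; apply: (@mulgl_continuous x^-1 x A); rewrite mulVg. Qed.

Lemma nbhs1_translateV (x : G) (A : set G) :
  nbhs 1 A -> nbhs x [set y | A (y^-1 * x)].
Proof.
move=> nA; apply: (@invg_continuous G x [set z | A (z * x)]).
by apply: (@mulgr_continuous x x^-1 A); rewrite mulVg.
Qed.

End PolishGroupTopology.

Lemma polish_hom1 (G H : polishGroupType) (f : polish_hom G H) : f 1%g = 1%g.
Proof. by apply: (mulgI (f 1%g)); rewrite -polish_homM !mulg1. Qed.

Lemma polish_homV (G H : polishGroupType) (f : polish_hom G H) x :
  (f x^-1 = (f x)^-1)%g.
Proof. by apply: (mulgI (f x)); rewrite -polish_homM !mulgV polish_hom1. Qed.

Section OpenMapping.
Variables (G H : polishGroupType) (f : polish_hom G H).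
Hypothesis fsurj : forall y, exists x, f x = y.
Local Open Scope group_scope.

(* Countably many translates of [f @` W] cover [H], so one of them is somewhere
   dense by Baire. *)
Lemma polish_hom_almost_open (A : set G) :
  nbhs 1 A -> nbhs 1 (closure (f @` A)).
Proof.
move=> /nbhs1_divl [W nW WA].
have [B] := polish_sieve H.
have [D cD dD] := @polish_separable G; have [e De] := countable_enum 1 cD.
pose F n := closure (f @` [set x | W ((e n)^-1 * x)]).
have cover y : exists n, F n y.
  have [x <-] := fsurj y.
  have nV := nbhs1_translateV x nW.
  have [|z [Wz /De [n _ en]]] := dD _ _ (@open_interior _ [set z | W (z^-1 * x)]).
    by exists x.
  exists n; apply: subset_closure; exists x => //=; rewrite en.
  exact: interior_subset Wz.
have [n [p pO]] := sieve_closed_cover B 1 (fun n => @closed_closure _ _) cover.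
(* Dividing by [f w], with [w] in the same translate, recentres the somewhere dense set at 1: the
   unknown [e n] cancels in [w^-1 * v]. *)
have [_ [[w /= Ww <-] /nbhs_interior wO]] := interior_subset pO _ (open_nbhs_nbhs
  (conj (@open_interior _ _) pO)).
apply: filterS (nbhs_translate wO) => h /interior_subset cFh.
have /= := closure_image_continuous (@mulgl_continuous _ (f w)^-1) cFh.
rewrite mulKg; apply: closureS => _ [_ [v /= Wv <-] <-].
exists (w^-1 * v); last by rewrite polish_homM polish_homV.
by have := WA _ _ Ww Wv; rewrite invgM invgK mulgA mulgK.
Qed.

Lemma polish_hom_almost_open_nbhs (x : G) (A : set G) :
  nbhs x A -> nbhs (f x) (closure (f @` A)).
Proof.
move=> /nbhs_translate /polish_hom_almost_open /(nbhs1_translate (f x)).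
apply: filterS => y cy.
have /= := closure_image_continuous (@mulgl_continuous _ (f x)) cy.
rewrite mulVKg; apply: closureS => _ [_ [v /= Av <-] <-].
by exists (x * v) => //; rewrite polish_homM.
Qed.

(* Following a sieve of [G] inside the dense open unions of the interiors of the
   [closure (f @` B j)], almost openness gives preimages of generic points. *)
Lemma polish_hom_comeagre (B : sieve G) : exists U : nat * nat -> set H,
  [/\ forall p, open (U p), forall p, dense (U p) &
    forall i y, (closure (f @` B i))° y -> (forall p, U p y) -> (f @` B i) y].
Proof.
pose E i := (closure (f @` B i))°.
have fE i x : B i x -> E i (f x).
  move=> Bx; apply: nbhs_singleton; apply: nbhs_interior.
  by apply: polish_hom_almost_open_nbhs; exact: open_nbhs_nbhs (conj (sieve_open B i) Bx).
pose D n i := \bigcup_(j in [set j | sieve_fine B n i j]) E j.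
have oD n i : open (D n i) by apply: bigcup_open => j _; apply: open_interior.
exists (fun p => D p.1 p.2 `|` ~` closure (E p.2)); split.
- by move=> p; apply: openU => //; apply: closed_openC; apply: closed_closure.
- move=> [n i]; apply: dense_setUCclosure => O oO [y [Oy /interior_subset cy]] /=.
  have [_ [[x Bx <-] Ox]] := cy _ (open_nbhs_nbhs (conj oO Oy)).
  have [j [ij Bj _]] := sieve_refine n Bx filterT.
  by exists (f x); split => //; exists j => //; apply: fE.
- move=> i y Ey Uy.
  have [//|n j /= Ej|s s0 sP] := @dependent_choice_nat nat (fun _ j => E j y)
    (sieve_fine B) i.
    case: (Uy (n, j)) => [[k jk Ek]|]; first by exists k.
    by case; apply: subset_closure.
  have [|x [xs xA]] := sieve_shrink (fun n => (sP n).2).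
    move=> n; have [_ [[x Bx _] _]] := interior_subset (sP n).1 _ filterT.
    by exists x.
  exists x; first by rewrite -s0.
  apply: completely_metrizable_closure; first exact: polish_completely_metrizable.
  move=> A /(@polish_hom_continuous _ _ f x) /xA [n BA].
  apply: closureS (interior_subset (sP n).1).
  by move=> _ [z /BA Az <-].
Qed.

(** For [h] in [E], the open sets [E] and [h * E] overlap. By Baire some [z] in the overlap is
    generic together with [h^-1 * z], so both have preimages [a], [b] in [B i], and
    [h = f (a * b^-1)]: the closures disappear. *)
Lemma polish_hom_nbhs1 (A : set G) : nbhs 1 A -> nbhs 1 (f @` A).
Proof.
move=> /nbhs1_divr [V nV VA].
have [B] := polish_sieve G; have [C] := polish_sieve H.
have [i Bi BV] := sieve_base B nV.
have [U [oU dU UP]] := polish_hom_comeagre B.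
pose E := (closure (f @` B i))°.
have oE : open E by apply: open_interior.
have E1 : E 1.
  rewrite -(polish_hom1 f); apply: nbhs_singleton; apply: nbhs_interior.
  by apply: polish_hom_almost_open_nbhs; exact: open_nbhs_nbhs (conj (sieve_open B i) Bi).
have nE : nbhs 1 E by exact: open_nbhs_nbhs (conj oE E1).
apply: filterS nE => h Eh.
have oT g (W : set H) : open W -> open [set z | W (g * z)].
  by move/continuousP: (@mulgl_continuous H g) => c /c.
pose U' (b : bool * (nat * nat)) := if b.1 then U b.2 else [set z | U b.2 (h^-1 * z)].
have [||||z [[/= Ez Ehz] zU]] := @sieve_baire _ C _ U' _ _ (E `&` [set z | E (h^-1 * z)]).
- by case=> -[] p; [apply: oU|apply: oT].
- case=> -[] p; first exact: dU.
  move=> O [x Ox] oO.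
  have [||y [Oy Uy]] := dU p [set z | O (h * z)].
  + by exists (h^-1 * x); rewrite /= mulVKg.
  + exact: oT.
  by exists (h * y); split => //; rewrite /U' /= mulKg.
- by exists h; split => //=; rewrite mulVg.
- by apply: openI => //; apply: oT.
have [|a Ba az] := UP i z Ez; first by move=> p; apply: (zU (true, p)).
have [|b Bb bz] := UP i _ Ehz; first by move=> p; apply: (zU (false, p)).
exists (a * b^-1); first by apply: VA; apply: BV.
by rewrite polish_homM polish_homV az bz invgM invgK mulVKg.
Qed.

Theorem polish_open_mapping (x : G) (A : set G) :
  nbhs x A -> nbhs (f x) (f @` A).
Proof.
move=> /nbhs_translate /polish_hom_nbhs1 /(nbhs1_translate (f x)).
apply: filterS => y [v /= Av vy]; exists (x * v) => //.
by rewrite polish_homM vy mulVKg.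
Qed.

Lemma polish_hom_open (A : set G) : open A -> open (f @` A).
Proof.
move=> oA; rewrite openE => _ [x Ax <-]; apply: polish_open_mapping.
exact: open_nbhs_nbhs.
Qed.

End OpenMapping.

(** * Borel sections of surjective homomorphisms *)

Section Borel.
Variable T : topologicalType.

Lemma borel_setC (A : set T) : <<s @open T >> A -> <<s @open T >> (~` A).
Proof. by move=> bA; rewrite -setTD; apply: sigma_algebraCD. Qed.

Lemma borel_bigcup_nat (P : set nat) (A : nat -> set T) :
  (forall n, <<s @open T >> (A n)) -> <<s @open T >> (\bigcup_(n in P) A n).
Proof.
move=> bA; rewrite bigcup_mkcond; apply: sigma_algebra_bigcup => n.
by case: ifP => // _; apply: sigma_algebra0.
Qed.

Lemma borel_setI (A B : set T) :
  <<s @open T >> A -> <<s @open T >> B -> <<s @open T >> (A `&` B).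
Proof.
move=> bA bB; rewrite -[_ `&` _]setCK setCI -bigcup2E.
apply: borel_setC; apply: sigma_algebra_bigcup => -[|[|n]] /=;
  [exact: borel_setC|exact: borel_setC|exact: sigma_algebra0].
Qed.

Lemma borel_functionP (U : topologicalType) (f : T -> U) :
  (forall O, open O -> <<s @open T >> (f @^-1` O)) -> borel_function f.
Proof.
move=> fO; apply: smallest_sub => //; split.
- by rewrite preimage_set0; apply: sigma_algebra0.
- by move=> A bA /=; rewrite setTD preimage_setC; apply: borel_setC.
- by move=> A bA /=; rewrite preimage_bigcup; apply: sigma_algebra_bigcup.
Qed.

Lemma continuous_borel (U : topologicalType) (f : T -> U) :
  continuous f -> borel_function f.
Proof.
move=> /continuousP cf; apply: borel_functionP => O /cf.
exact: sub_sigma_algebra.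
Qed.

End Borel.

Lemma borel_function_comp (T U V : topologicalType) (g : U -> V) (f : T -> U) :
  borel_function g -> borel_function f -> borel_function (g \o f).
Proof. by move=> bg bf A /bg /bf. Qed.

Definition least (P : nat -> Prop) : nat :=
  xget 0%N [set i | P i /\ forall k, (k < i)%N -> ~ P k].

Lemma leastP (P : nat -> Prop) i : (exists i, P i) ->
  least P = i <-> P i /\ forall k, (k < i)%N -> ~ P k.
Proof.
move=> exP; rewrite /least; case: xgetP => [j _ [Pj mj]|no]; last first.
  have exP' : exists i, `[< P i >] by have [j Pj] := exP; exists j; apply/asboolP.
  case: (ex_minnP exP') => j /asboolP Pj mj; case: (no j); split=> // k kj Pk.
  by have := mj k (asboolT Pk); rewrite leqNgt kj.
split=> [<-//|[Pi mi]]; apply/eqP; rewrite eqn_leq.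
by apply/andP; split; rewrite leqNgt; apply/negP; [move=> /mj|move=> /mi].
Qed.

Section BorelSection.
Variables (G H : polishGroupType) (f : polish_hom G H).
Hypothesis fsurj : forall y, exists x, f x = y.

Theorem polish_hom_borel_section :
  exists2 s : H -> G, borel_function s & forall h, f (s h) = h.
Proof.
have [B] := polish_sieve G.
pose fix idx h n := match n with
  | 0%N => least (fun i => (f @` B i) h)
  | m.+1 => least (fun i => sieve_fine B m (idx h m) i /\ (f @` B i) h) end.
have ex0 h : exists i, (f @` B i) h.
  have [x <-] := fsurj h; have [i Bi _] := sieve_base B (@filterT _ (nbhs x) _).
  by exists i; exists x.
have exS h n j : (f @` B j) h -> exists i, sieve_fine B n j i /\ (f @` B i) h.
  move=> [x Bx <-]; have [i [ji Bi _]] := sieve_refine n Bx (@filterT _ (nbhs x) _).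
  by exists i; split => //; exists x.
have inB h n : (f @` B (idx h n)) h.
  by elim: n => [|n IH] /=; [have [] := (leastP _ (ex0 h)).1 erefl|
    have [[]] := (leastP _ (exS _ n _ IH)).1 erefl].
have fine h n : sieve_fine B n (idx h n) (idx h n.+1).
  by have [[]] := (leastP _ (exS _ n _ (inB h n))).1 erefl.
have lim h : exists x, (forall n, B (idx h n) x) /\
    forall A, nbhs x A -> exists n, B (idx h n) `<=` A.
  by apply: sieve_shrink (fine h) _ => n; have [x Bx _] := inB h n; exists x.
have [s sP] := choice lim.
have bf i : <<s @open H >> (f @` B i).
  by apply: sub_sigma_algebra; apply: polish_hom_open => //; apply: sieve_open.
have bleast (P : nat -> set H) i : (forall k, <<s @open H >> (P k)) ->
    <<s @open H >> [set h | P i h /\ forall k, (k < i)%N -> ~ P k h].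
  move=> bP; rewrite (_ : mkset _ = P i `&` ~` \bigcup_(k in [set k | (k < i)%N]) P k).
    by apply: borel_setI => //; apply: borel_setC; apply: borel_bigcup_nat.
  apply/seteqP; split=> h [Ph mh]; split=> //; first by move=> [k /mh].
  by move=> k ki Pk; apply: mh; exists k.
have bidx n i : <<s @open H >> [set h | idx h n = i].
  elim: n i => [|n IH] i /=.
    rewrite (_ : mkset _ = [set h | (f @` B i) h /\ forall k, (k < i)%N -> ~ (f @` B k) h]).
      exact: (bleast (fun i => f @` B i)).
    by apply/seteqP; split=> h /(leastP _ (ex0 h)).
  rewrite (_ : mkset _ = \bigcup_j ([set h | idx h n = j] `&`
    [set h | (sieve_fine B n j i /\ (f @` B i) h) /\ forall k, (k < i)%N ->
       ~ (sieve_fine B n j k /\ (f @` B k) h)])); last first.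
    apply/seteqP; split=> h.
      move=> /(leastP _ (exS _ n _ (inB h n))) hi; by exists (idx h n).
    by move=> [j _ [/= <- hi]]; apply/leastP => //; apply: exS.
  apply: borel_bigcup_nat => j; apply: borel_setI => //.
  apply: (bleast (fun i => [set h | sieve_fine B n j i /\ (f @` B i) h])) => k.
  have [jk|jk] := pselect (sieve_fine B n j k).
    by rewrite (_ : mkset _ = f @` B k) //; apply/seteqP; split=> h // [].
  rewrite (_ : mkset _ = set0); first exact: sigma_algebra0.
  by apply/seteqP; split=> h // [].
exists s.
  apply: borel_functionP => O oO.
  (* Some member of the chain of [h] lies inside [O] exactly when its limit [s h] is in [O]. *)
  rewrite (_ : s @^-1` O =
    \bigcup_n \bigcup_(i in [set i | B i `<=` O]) [set h | idx h n = i]).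
    by do 2 apply: borel_bigcup_nat => ?.
  apply/seteqP; split=> h.
    move=> /= Os; have [n BO] := (sP h).2 _ (open_nbhs_nbhs (conj oO Os)).
    by exists n => //; exists (idx h n).
  by move=> [n _ [i /= BO hi]]; apply: BO; rewrite -hi; apply: (sP h).1.
move=> h; apply: completely_metrizable_closure.
  exact: polish_completely_metrizable.
move=> A /(@polish_hom_continuous _ _ f) /(sP h).2 [n BA].
by apply: subset_closure; have [x /BA Ax <-] := inB h n.
Qed.

End BorelSection.

(** * Closed subgroups and images *)

Section Subgroup.
Variables (G : groupType) (A : set G) (sA : is_subgroup A).
Local Open Scope group_scope.

(* The topology is given by its open sets, so that the same group carries the
   subspace topology of a closed subgroup and the quotient topology of an image. *)
Variable op : set_system (set_type A).
Hypotheses (opT : op setT) (opI : setI_closed op).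
Hypothesis opU : forall (I : Type) (F : I -> set (set_type A)),
  (forall i, op (F i)) -> op (\bigcup_i F i).

(** The [let] bindings make the proofs parameters of the type, from which the group and topology
    instances recover them. *)
Definition subgroup_top : Type := let _ := sA in let _ := opT in
  let _ := opI in let _ := opU in set_type A.
HB.instance Definition _ := Choice.on subgroup_top.
Local Notation K := subgroup_top.

Definition subgroup_val (x : K) : G := set_val x.

Lemma subgroup_val_inj : injective subgroup_val.
Proof. exact: val_inj. Qed.

Lemma subgroup_valP x : A (subgroup_val x).
Proof. exact: set_valP. Qed.

Definition subgroup_mk (x : G) (Ax : A x) : K := exist _ x (mem_set Ax).

Definition subgroup_one : K := subgroup_mk (let: And3 h _ _ := sA in h).
Definition subgroup_mul (x y : K) : K :=
  subgroup_mk (let: And3 _ h _ := sA in h _ _ (subgroup_valP x) (subgroup_valP y)).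
Definition subgroup_inv (x : K) : K :=
  subgroup_mk (let: And3 _ _ h := sA in h _ (subgroup_valP x)).

Lemma subgroup_mulA : associative subgroup_mul.
Proof. by move=> x y z; apply: subgroup_val_inj; apply: mulgA. Qed.
Lemma subgroup_mul1 : left_id subgroup_one subgroup_mul.
Proof. by move=> x; apply: subgroup_val_inj; apply: mul1g. Qed.
Lemma subgroup_1mul : right_id subgroup_one subgroup_mul.
Proof. by move=> x; apply: subgroup_val_inj; apply: mulg1. Qed.
Lemma subgroup_mulV : left_inverse subgroup_one subgroup_inv subgroup_mul.
Proof. by move=> x; apply: subgroup_val_inj; apply: mulVg. Qed.
Lemma subgroup_Vmul : right_inverse subgroup_one subgroup_inv subgroup_mul.
Proof. by move=> x; apply: subgroup_val_inj; apply: mulgV. Qed.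

HB.instance Definition _ := isGroup.Build K subgroup_mulA
  subgroup_mul1 subgroup_1mul subgroup_mulV subgroup_Vmul.
HB.instance Definition _ := isOpenTopological.Build K opT opI opU.

Lemma subgroup_openE : @open K = op.
Proof. by []. Qed.

End Subgroup.

Section ClosedSubgroup.
Variables (G : polishGroupType) (A : set G).
Hypotheses (sA : is_subgroup A) (cA : closed A).

Definition subspace_open : set_system (set_type A) :=
  [set (@set_val _ A) @^-1` O | O in open].

Lemma subspace_openT : subspace_open setT.
Proof. by exists setT => //; exact: openT. Qed.

Lemma subspace_openI : setI_closed subspace_open.
Proof.
by move=> _ _ [O oO <-] [P oP <-]; exists (O `&` P) => //; apply: openI.
Qed.

Lemma subspace_open_bigU (I : Type) (F : I -> set (set_type A)) :
  (forall i, subspace_open (F i)) -> subspace_open (\bigcup_i F i).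
Proof.
move=> oF; exists (\bigcup_(O in [set O | open O /\
    @set_val _ A @^-1` O `<=` \bigcup_i F i]) O).
  by apply: bigcup_open => O [].
apply/seteqP; split=> x; first by move=> [O [_ OF] Ox]; apply: OF.
move=> [i _ Fx]; have [O oO OF] := oF i; exists O; last by rewrite -OF in Fx.
by split=> // y Oy; exists i => //; rewrite -OF.
Qed.

Local Notation K := (subgroup_top sA subspace_openT subspace_openI subspace_open_bigU).
Local Notation v := (@subgroup_val G A sA _ subspace_openT subspace_openI subspace_open_bigU).

Lemma subgroup_val_continuous : continuous v.
Proof. by apply/continuousP => O oO; exists O. Qed.

Lemma subspace_continuousP (T : topologicalType) (f : T -> K) :
  continuous (v \o f) -> continuous f.
Proof.
move=> /continuousP vf; apply/continuousP => _ [O oO <-]; exact: vf.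
Qed.

Lemma subspace_nbhsP (x : K) (W : set K) :
  nbhs x W <-> exists2 O, nbhs (v x) O & v @^-1` O `<=` W.
Proof.
split.
  rewrite nbhsE => -[_ [[O oO <-] Ox] OW]; exists O => //.
  exact: open_nbhs_nbhs.
by move=> [O /subgroup_val_continuous nO OW]; apply: filterS OW nO.
Qed.

Lemma closed_subgroup_mulg_continuous : continuous (fun x : K * K => (x.1 * x.2)%g).
Proof.
apply: subspace_continuousP => x.
apply: (@continuous_comp _ _ _ (fun x : K * K => (v x.1, v x.2))
  (fun z : G * G => (z.1 * z.2)%g)); last exact: mulg_continuous.
apply: cvg_pair.
  by apply: (@continuous_comp _ _ _ fst v); [apply: cvg_fst|apply: subgroup_val_continuous].
by apply: (@continuous_comp _ _ _ snd v); [apply: cvg_snd|apply: subgroup_val_continuous].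
Qed.

Lemma closed_subgroup_invg_continuous : continuous (fun x : K => (x^-1)%g).
Proof.
apply: subspace_continuousP => x.
apply: (@continuous_comp _ _ _ v (fun z : G => (z^-1)%g)).
  exact: subgroup_val_continuous.
exact: invg_continuous.
Qed.

Lemma closed_subgroup_metric (d : G -> G -> R) : is_metric d -> metrizes d ->
  is_metric (fun x y : K => d (v x) (v y)) /\
  metrizes (fun x y : K => d (v x) (v y)).
Proof.
move=> [d0 ds dt] dT; split; first split=> // x y.
  split=> [/d0|->]; [exact: subgroup_val_inj|exact/d0].
move=> x W; split.
  move=> /subspace_nbhsP [O /dT [e e0 eO] OW]; exists e => // y /eO; exact: OW.
move=> [e e0 eW]; apply/subspace_nbhsP; exists [set y | (d (v x) y < e)%R] => //.
by apply/dT; exists e.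
Qed.

Lemma closed_subgroup_completely_metrizable : completely_metrizable K.
Proof.
have [d [dm dT dc]] := @polish_completely_metrizable G.
have [vm vT] := closed_subgroup_metric dm dT.
exists (fun x y => d (v x) (v y)); split=> // u cu.
have [a ua] := dc (v \o u) cu.
have Aa : A a.
  apply: cA => W /ua [N _ hN]; exists (v (u N)); split; first exact: subgroup_valP.
  by apply: hN => /=.
exists (subgroup_mk _ _ _ _ Aa); apply: (metric_cvg vT) => e e0.
exact: (cvg_metric dT ua).
Qed.

Lemma closed_subgroup_separable : separable K.
Proof.
have [d [dm dT dc]] := @polish_completely_metrizable G.
have [vm vT] := closed_subgroup_metric dm dT.
have [D cD dD] := (metric_separableP dm dT).1 (@polish_separable G).
have [e De] := countable_enum (1%g : G) cD.
apply/(metric_separableP vm vT).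
(* A dense sequence of [G] may miss [A], so points of [K] close to its terms are chosen; when there
   is none the default 1 does no harm. *)
pose c (p : nat * nat) : K := xget 1%g [set x : K | (d (e p.1) (v x) < p.2.+1%:R^-1)%R].
exists (range c).
  by apply: sub_countable (countableP [set: nat * nat]); apply: card_image_le.
move=> x a a0; have [|k] := ltr_add_invr (y := 0%R) (x := (a / 2)%R).
  by rewrite divr_gt0.
rewrite add0r => ka; have k0 : (0 < k.+1%:R^-1 :> R)%R by rewrite invr_gt0 ltr0n.
have [_ /De [n _ <-] xn] := dD (v x) _ k0.
have [_ ds dt] := dm.
exists (c (n, k)); first by exists (n, k).
apply: le_lt_trans (dt _ (e n) _) _; rewrite [a]splitr; apply: ltrD.
  exact: lt_trans ka.
apply: lt_trans ka; rewrite /c; case: xgetP => [y _ //|/(_ x)] /=.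
by rewrite ds.
Qed.

Definition closed_subgroup : polishGroupType :=
  HB.pack K (isPolishGroup.Build K closed_subgroup_mulg_continuous
  closed_subgroup_invg_continuous closed_subgroup_completely_metrizable
  closed_subgroup_separable).

Definition closed_subgroup_incl : polish_hom closed_subgroup G :=
  @PolishHom closed_subgroup G v (fun _ _ => erefl) subgroup_val_continuous.

End ClosedSubgroup.

Theorem closed_subgroup_polish (G : polishGroupType) (A : set G) :
  is_subgroup A -> closed A -> exists (K : polishGroupType) (i : polish_hom K G),
    polish_topology A i /\ forall (U : polishGroupType) (f : polish_hom U G),
      (forall x, A (f x)) -> exists g : polish_hom U K, forall x, i (g x) = f x.
Proof.
move=> sA cA; exists (closed_subgroup sA cA), (closed_subgroup_incl sA cA).
split; first split; first exact: subgroup_val_inj.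
  apply/seteqP; split=> [_ [x _ <-]|x Ax]; first exact: subgroup_valP.
  by exists (subgroup_mk _ _ _ _ Ax).
move=> U f Af.
pose g x : closed_subgroup sA cA := subgroup_mk sA _ _ _ (Af x).
have gM : {morph g : x y / (x * y)%g}.
  by move=> x y; apply: subgroup_val_inj; apply: polish_homM.
have gc : continuous g.
  apply: subspace_continuousP; exact: (@polish_hom_continuous _ _ f).
by exists (PolishHom gM gc).
Qed.

(** A countable uniformity comes with pseudometric balls; the infimum of the admissible radii turns
    them into a real-valued distance. *)
Lemma countable_uniformity_distance (T : uniformType) : countable_uniformity T ->
  exists d : T -> T -> R, [/\ forall x, d x x = 0%R, forall x y, d x y = d y x,
    forall x y z, (d x z <= d x y + d y z)%R,
    forall E, entourage E -> exists2 e : R, (0 < e)%R &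
      forall x y, (d x y < e)%R -> E (x, y) &
    forall e : R, (0 < e)%R -> entourage [set p | (d p.1 p.2 < e)%R]].
Proof.
move=> cT; pose M : pseudoMetricType R := @countable_uniform T cT.
pose bx (x y : M) := [set e : R | (0 < e)%R /\ ball x e y].
pose d (x y : T) : R := inf (bx x y).
have lb x y : lbound (bx x y) 0%R by move=> e [/ltW].
(* In this ball structure any two points are within radius 2. *)
have ne x y : bx x y !=set0.
  by exists 2%R; split=> //; apply: countable_uniform.countable_uniform_bounded.
have hi x y : has_inf (bx x y) by split; [apply: ne|exists 0%R; apply: lb].
have dlt x y e : (d x y < e)%R -> ball (x : M) e y.
  by move=> /(inf_lt (ne x y)) [a [_ xy] /ltW ae]; apply: le_ball xy.
have dle x y e : (0 < e)%R -> ball (x : M) e y -> (d x y <= e)%R.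
  by move=> e0 xy; apply: ge_inf; [exists 0%R; apply: lb|].
have d0 x y : (0 <= d x y)%R by apply: lb_le_inf.
have ent (E : set (T * T)) : entourage E <-> exists2 e : R, (0 < e)%R &
    [set p : M * M | ball p.1 e p.2] `<=` E.
  by rewrite -[entourage E]/(@entourage M E) -entourage_ballE.
exists d; split.
- move=> x; apply: le_anti; rewrite d0 andbT; apply/ler_addgt0Pr => e e0.
  by rewrite add0r; apply: dle => //; apply: ball_center_subproof.
- by move=> x y; rewrite /d; congr inf; apply/seteqP; split=> e [e0] /ball_sym.
- move=> x y z; apply/ler_addgt0Pr => e e0.
  have e20 : (0 < e / 2)%R by rewrite divr_gt0.
  have h (a b : T) : ball (a : M) (d a b + e / 2)%R b by apply: dlt; rewrite ltrDl.
  apply: le_trans (dle _ _ _ _ (ball_triangle (h x y) (h y z))) _.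
    by rewrite addr_gt0 // ltr_wpDl.
  by rewrite addrACA -splitr.
- by move=> E /ent [e e0 eE]; exists e => // x y /dlt xy; apply: (eE (x, y)).
(* A ball of radius [e] only gives a distance at most [e]; halving makes the inequality strict. *)
- move=> e e0; apply/ent; exists (e / 2)%R; first by rewrite divr_gt0.
  move=> [x y] /= xy; apply: le_lt_trans (dle _ _ _ _ xy) _.
    by rewrite divr_gt0.
  by rewrite ltr_pdivrMr // mulr_natr mulr2n ltrDl.
Qed.

(** * Images of homomorphisms with the quotient topology *)

Section Image.
Variables (X Y : polishGroupType) (f : polish_hom X Y).
Local Open Scope group_scope.

Lemma range_subgroup : is_subgroup (range f).
Proof.
split.
- by exists 1 => //; rewrite polish_hom1.
- by move=> _ _ [x _ <-] [y _ <-]; exists (x * y); rewrite ?polish_homM.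
- by move=> _ [x _ <-]; exists x^-1; rewrite ?polish_homV.
Qed.

Definition corange (x : X) : set_type (range f) :=
  exist _ (f x) (mem_set (ex_intro2 _ _ x I erefl)).

(** The quotient topology by the kernel, carried by the range. The subspace topology of [Y] would be
    Polish only for a closed range. *)
Definition image_open : set_system (set_type (range f)) :=
  [set O | open (corange @^-1` O)].

Lemma image_openT : image_open setT.
Proof. exact: openT. Qed.

Lemma image_openI : setI_closed image_open.
Proof. by move=> O P oO oP; apply: openI. Qed.

Lemma image_open_bigU (I : Type) (F : I -> set (set_type (range f))) :
  (forall i, image_open (F i)) -> image_open (\bigcup_i F i).
Proof.
move=> oF; rewrite /image_open/= preimage_bigcup; apply: bigcup_open => i _.
exact: oF.
Qed.

Local Notation Q := (subgroup_top range_subgroup image_openT image_openI image_open_bigU).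
Local Notation v := (@subgroup_val Y (range f) range_subgroup _ image_openT
  image_openI image_open_bigU).
Definition image_pr (x : X) : Q := corange x.
Local Notation q := image_pr.

Lemma image_prM : {morph q : x y / x * y}.
Proof. by move=> x y; apply: subgroup_val_inj; apply: polish_homM. Qed.

Lemma image_pr1 : q 1 = 1.
Proof. by apply: subgroup_val_inj; apply: polish_hom1. Qed.

Lemma image_prV x : q x^-1 = (q x)^-1.
Proof. by apply: subgroup_val_inj; apply: polish_homV. Qed.

Lemma image_pr_surj (y : Q) : exists x, q x = y.
Proof.
have [x _ fx] := subgroup_valP y; exists x.
exact: subgroup_val_inj.
Qed.

Lemma image_pr_continuous : continuous q.
Proof. by apply/continuousP. Qed.

(** The saturation of [O] is the union of its translates by kernel elements, hence open. *)
Lemma image_pr_open (O : set X) : open O -> open (q @` O).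
Proof.
move=> oO; rewrite subgroup_openE /image_open /=.
rewrite (_ : _ @^-1` _ = \bigcup_(n in [set n | f n = 1]) [set x | O (x * n)]).
  apply: bigcup_open => n _.
  by have /continuousP := @mulgr_continuous X n; apply.
apply/seteqP; split=> x.
  move=> [y Oy] /(congr1 v) /= yx; exists (x^-1 * y); last by rewrite /= mulVKg.
  rewrite /= polish_homM polish_homV -[f y]/(v (q y)) yx; exact: mulVg.
move=> [n /= fn On]; exists (x * n) => //; apply: subgroup_val_inj.
by rewrite -[LHS]/(f (x * n)) polish_homM fn mulg1.
Qed.

Lemma image_pr_nbhs (x : X) (A : set X) : nbhs x A -> nbhs (q x) (q @` A).
Proof.
rewrite nbhsE => -[O [oO Ox] OA]; rewrite nbhsE; exists (q @` O).
  by split; [apply: image_pr_open|exists x].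
exact: image_subset.
Qed.

Lemma image_mulg_continuous : continuous (fun x : Q * Q => x.1 * x.2).
Proof.
move=> [p r] A /=; have [x <-] := image_pr_surj p; have [y <-] := image_pr_surj r.
rewrite -image_prM => /image_pr_continuous /polish_nbhs_mul [B nB [C nC BC]].
exists (q @` B, q @` C); first by split; apply: image_pr_nbhs.
by move=> [_ _] [/= [b Bb <-] [c Cc <-]]; rewrite -image_prM; apply: BC.
Qed.

Lemma image_invg_continuous : continuous (fun x : Q => x^-1).
Proof.
move=> p A /=; have [x <-] := image_pr_surj p.
rewrite -image_prV => /image_pr_continuous nA.
have := image_pr_nbhs (@invg_continuous X x _ nA); apply: filterS.
by move=> _ [y Ay <-]; rewrite /= -image_prV.
Qed.

Lemma image_val_continuous : continuous v.
Proof.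
apply/continuousP => O oO; rewrite subgroup_openE /image_open /=.
have /continuousP := @polish_hom_continuous _ _ f; exact.
Qed.

Lemma image_separable : separable Q.
Proof.
have [D cD dD] := @polish_separable X.
exists (q @` D); first by apply: sub_countable cD; apply: card_image_le.
move=> O [p Op] oO; have [x xp] := image_pr_surj p.
have [||y [Oy Dy]] := dD (q @^-1` O).
- by exists x; rewrite /= xp.
- by have /continuousP := image_pr_continuous; apply.
by exists (q y); split => //; exists y.
Qed.

(* Completeness for the two-sided uniformity.  The limit is found as
   [q x^-1 * q y], where [x] and [y] are limits of nested chains [B a_k] and
   [B b_k] with [q (B a_k) * u n] inside [q (B b_k)] for large [n]. *)
Lemma image_two_sided_complete (u : nat -> Q) :
  (forall A : set Q, nbhs (1 : Q) A -> exists N, forall m n, (N <= m)%N -> (N <= n)%N ->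
    A ((u m)^-1 * u n) /\ A (u m * (u n)^-1)) ->
  exists p : Q, u @ \oo --> p.
Proof.
move=> cu; have [B] := polish_sieve X.
pose J (p : nat * nat) := B p.1 !=set0 /\ exists N, forall n, (N <= n)%N ->
  forall x, B p.1 x -> exists2 y, B p.2 y & q x * u n = q y.
(* This uses the left Cauchy condition on [(u m)^-1 * u k]. The bound [N] depends only on [y] and
   [b0], so [m] and [x] may be chosen after it. *)
have half y b0 : B b0 y -> exists N, forall m x, (N <= m)%N -> q x * u m = q y ->
    exists2 T, nbhs x T & forall k z, (m <= k)%N -> T z ->
      exists2 w, B b0 w & q z * u k = q w.
  move=> By; have nB : nbhs y (B b0) := open_nbhs_nbhs (conj (sieve_open B b0) By).
  have [S1 nS1 [S2 nS2 S12]] := @polish_nbhs_mul X 1 1 [set w | B b0 (y * w)]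
    (eq_ind_r (nbhs^~ _) (nbhs_translate nB) (mulg1 1)).
  have n1S2 : nbhs (1 : Q) (q @` S2) by rewrite -image_pr1; apply: image_pr_nbhs.
  have [N hN] := cu _ n1S2; exists N => m x Nm xE.
  have [t tE] := image_pr_surj (u m).
  exists [set z | S1 (t^-1 * ((x^-1 * z) * t))].
    apply: (@nbhs1_translate X x [set z | S1 (t^-1 * (z * t))]).
    apply: (@mulgr_continuous X t 1 [set z | S1 (t^-1 * z)]).
    by rewrite mul1g; apply: nbhs1_translate.
  move=> k z mk /= S1t; have [w S2w wE] := (hN m k Nm (leq_trans Nm mk)).1.
  exists (y * (t^-1 * (x^-1 * z * t) * w)); first exact: S12.
  rewrite !image_prM !image_prV -xE wE tE !mulgA.
  by rewrite !(mulgK, mulgVK) mulgV mul1g.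
have step n p : J p -> exists2 p', sieve_fine B n p.1 p'.1 /\
    sieve_fine B n p.2 p'.2 & J p'.
  case: p => a b [/= [x Bx] [N hN]].
  have nW : nbhs (1 : Q) [set w | (q @` B a) (q x * w)].
    have := image_pr_nbhs (open_nbhs_nbhs (conj (sieve_open B a) Bx)).
    move=> h; have [C nC [D nD CD]] := @nbhs_op2 _ _ _ _ (q x) (1 : Q) _ image_mulg_continuous
      (eq_ind_r (nbhs^~ _) h (mulg1 (q x))).
    by apply: filterS nD => w Dw; apply: CD => //; exact: nbhs_singleton nC.
  have [N1 hN1] := cu _ nW; pose m := maxn N N1.
  have [y By yE] := hN m (leq_maxl _ _) x Bx.
  have [b' [bb' Bb' _]] := sieve_refine n By (@filterT _ (nbhs y) _).
  have [N2 hN2] := half _ _ Bb'; pose m2 := maxn m N2.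
  have mm2 : (m <= m2)%N := leq_maxl _ _.
  have N1m : (N1 <= m)%N := leq_maxr _ _.
  (* The right Cauchy condition moves [x] inside [B a] to [x'] with [q x' * u m2 = q y], so that
     [half] applies at the later index [m2]. *)
  have [x' Bx' x'E] := (hN1 m m2 N1m (leq_trans N1m mm2)).2.
  have [|T nT hT] := hN2 m2 x' (leq_maxr _ _).
    by rewrite x'E -yE !mulgA mulgVK.
  have [a' [aa' Ba' a'T]] := sieve_refine n Bx' nT.
  exists (a', b') => //; split; first by exists x'.
  by exists m2 => k m2k z /a'T; apply: hT.
have [p0 Jp0] : exists p0, J p0.
  have [b Bb _] := sieve_base B (@filterT _ (nbhs (1 : X)) _).
  have [N /(_ N)hN] := half _ _ Bb; have [x xE] := image_pr_surj (u N)^-1.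
  have [|T nT hT] := hN x (leqnn _); first by rewrite xE mulVg image_pr1.
  have [a Ba aT] := sieve_base B nT.
  exists (a, b); split; first by exists x.
  by exists N => k Nk z /aT; apply: hT.
have [s _ sP] := dependent_choice_nat (P := fun=> J) Jp0 step.
have [|x [xs xA]] := sieve_shrink (fun n => (sP n).2.1).
  by move=> n; have [] := (sP n).1.
have [|y [ys yA]] := sieve_shrink (fun n => (sP n).2.2).
  move=> n; have [[x' Bx] [N hN]] := (sP n).1.
  by have [y By _] := hN N (leqnn _) _ Bx; exists y.
exists ((q x)^-1 * q y); rewrite -image_prV -image_prM.
move=> A /image_pr_continuous /(@mulgl_continuous X x^-1) /yA [k BA].
have [_ [N hN]] := (sP k).1.
exists N => // n /= /hN /(_ _ (xs k)) [y' /BA /= Ay e].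
by move: Ay; rewrite image_prM -e image_prV mulKg.
Qed.

Definition two_sided : Type := Q.
HB.instance Definition _ := Topological.on two_sided.

(** The join of the left and right uniformities. Being Cauchy for it controls both quotients, as
    [image_two_sided_complete] requires. *)
Definition two_sided_entourage : set_system (two_sided * two_sided) :=
  filter_from (nbhs (1 : Q))
    (fun A => [set p | A ((p.1 : Q)^-1 * p.2) /\ A ((p.1 : Q) * (p.2 : Q)^-1)]).

Lemma two_sided_filter : Filter two_sided_entourage.
Proof.
apply: filter_from_filter; first by exists setT; apply: filterT.
move=> A B nA nB; exists (A `&` B); first exact: filterI.
by move=> [x y] /= [[A1 B1] [A2 B2]].
Qed.

Lemma two_sided_diagonal E : two_sided_entourage E -> diagonal `<=` E.
Proof.
move=> [A /nbhs_singleton A1 AE] [x _] /diagonalP <-; apply: AE.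
by rewrite /= mulVg mulgV.
Qed.

Lemma two_sided_inv E : two_sided_entourage E -> two_sided_entourage (E^-1)%relation.
Proof.
move=> [A nA AE]; exists [set z | A z^-1].
  by apply: image_invg_continuous; rewrite invg1.
by move=> [x y] /= []; rewrite !invgM !invgK => h1 h2; apply: AE.
Qed.

Lemma two_sided_split E : two_sided_entourage E ->
  exists2 F, two_sided_entourage F & (F \; F `<=` E)%relation.
Proof.
move=> [A nA AE].
have [B nB [C nC BC]] := @nbhs_op2 _ _ _ _ (1 : Q) (1 : Q) _ image_mulg_continuous
  (eq_ind_r (nbhs^~ A) nA (mulg1 1)).
exists [set p | (B `&` C) ((p.1 : Q)^-1 * p.2) /\ (B `&` C) ((p.1 : Q) * (p.2 : Q)^-1)].
  by exists (B `&` C) => //; apply: filterI.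
move=> [x z] [y /= [[xy1 xy2] [xy3 xy4]] [[yz1 yz2] [yz3 yz4]]]; apply: AE.
split => /=.
  by have := BC _ _ xy1 yz2; rewrite /= mulgA mulgK.
by have := BC _ _ xy3 yz4; rewrite /= mulgA mulgVK.
Qed.

Lemma image_mull_continuous (x : Q) : continuous (fun y : Q => x * y).
Proof.
move=> y A nA; have [B nB [C nC BC]] := nbhs_op2 image_mulg_continuous nA.
by apply: filterS nC => z Cz; apply: BC => //; exact: nbhs_singleton nB.
Qed.

Lemma image_mulVr_continuous (x : Q) : continuous (fun y : Q => x * y^-1).
Proof.
move=> y; apply: (@continuous_comp _ _ _ (fun y : Q => y^-1) (fun y => x * y)).
  exact: image_invg_continuous.
exact: image_mull_continuous.
Qed.

Lemma two_sided_nbhs : nbhs = nbhs_ two_sided_entourage :> (two_sided -> _).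
Proof.
apply/funext => x; apply/seteqP; split=> A.
  move=> nA; exists [set p | A ((x : Q) * ((p.1 : Q)^-1 * p.2))].
    exists [set z | A ((x : Q) * z)]; last by move=> [y z] /= [].
    by apply: (@image_mull_continuous x 1 A); rewrite mulg1.
  by move=> y /xsectionP /=; rewrite mulVKg.
move=> [E [B nB BE] EA]; apply: (@filterS _ (nbhs (x : Q)) _
    ([set y : Q | B ((x : Q)^-1 * y)] `&`
    [set y : Q | B ((x : Q) * y^-1)])).
  by move=> y [B1 B2]; apply: EA; apply/xsectionP; apply: BE.
apply: filterI.
  by apply: (@image_mull_continuous (x : Q)^-1 x B); rewrite mulVg.
by apply: (@image_mulVr_continuous (x : Q) x B); rewrite mulgV.
Qed.

HB.instance Definition _ := Nbhs_isUniform_mixin.Build two_sided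
  two_sided_filter two_sided_diagonal two_sided_inv two_sided_split two_sided_nbhs.

Lemma two_sided_countable : countable_uniformity two_sided.
Proof.
have [B] := polish_sieve X; apply/countable_uniformityP.
(* The sieve members around 1 give a countable base there; the other indices contribute the whole
   space. *)
pose C i := if `[< B i 1 >] then q @` B i else setT.
have nC i : nbhs (1 : Q) (C i).
  rewrite /C; case: asboolP => [B1|_]; last exact: filterT.
  rewrite -image_pr1; apply: image_pr_nbhs.
  exact: open_nbhs_nbhs (conj (sieve_open B i) B1).
exists (fun i => [set p | C i ((p.1 : Q)^-1 * p.2) /\ C i ((p.1 : Q) * (p.2 : Q)^-1)]).
  move=> E [A nA AE].
  have [|i Bi BA] := sieve_base B (x := 1) (A := q @^-1` A).
    by apply: image_pr_continuous; rewrite image_pr1.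
  exists i => p /=; rewrite /C; case: asboolP => // _ [[x Bx xE] [y By yE]].
  by apply: AE; rewrite /= -xE -yE; split; apply: BA.
by move=> i; exists (C i).
Qed.

Lemma image_completely_metrizable : completely_metrizable Q.
Proof.
have [d [dxx ds dt dE ed]] := countable_uniformity_distance two_sided_countable.
have dT : metrizes (d : Q -> Q -> R).
  move=> x A; split.
    rewrite -[nbhs x A]/(nbhs (x : two_sided) A) -nbhs_entourageE.
    move=> [E /dE [e e0 eE] EA]; exists e => // y /= xy.
    by apply: EA; apply/xsectionP; apply: eE.
  move=> [e e0 eA]; rewrite -[nbhs x A]/(nbhs (x : two_sided) A) -nbhs_entourageE.
  by exists [set p | (d p.1 p.2 < e)%R]; [apply: ed|move=> y /xsectionP /eA].
exists d; split=> //.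
  (* Points at distance 0 agree because the image injects continuously into the Hausdorff group
     [Y]. *)
  split=> // x y; split=> [xy|->//].
  apply: subgroup_val_inj; apply: completely_metrizable_nbhs_eq.
    exact: polish_completely_metrizable.
  move=> A /(@image_val_continuous x) /dT [e e0 eA]; apply: eA => /=.
  by rewrite xy.
move=> u cu; apply: image_two_sided_complete => A nA.
have [|e e0 eE] := dE [set p | A ((p.1 : Q)^-1 * p.2) /\ A ((p.1 : Q) * (p.2 : Q)^-1)].
  by exists A.
have [N hN] := cu e e0; exists N => m n Nm Nn.
exact: (eE _ _ (hN m n Nm Nn)).
Qed.

Definition image_group : polishGroupType :=
  HB.pack Q (isPolishGroup.Build Q image_mulg_continuous image_invg_continuous
    image_completely_metrizable image_separable).

End Image.

Theorem polish_image_factorization (X Y : polishGroupType) (f : polish_hom X Y) :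
  exists (Q : polishGroupType) (e : polish_hom X Q) (m : polish_hom Q Y),
    [/\ forall y, exists x, e x = y, injective m & forall x, m (e x) = f x].
Proof.
exists (image_group f).
exists (@PolishHom X (image_group f) _ (@image_prM _ _ f) (@image_pr_continuous _ _ f)).
exists (@PolishHom (image_group f) Y _ (fun _ _ => erefl) (@image_val_continuous _ _ f)).
by split=> //; exact: image_pr_surj.
Qed.

(** * Regularity of the category of Polish groups *)

Local Open Scope cat_scope.

Definition polish_fst (G H : polishGroupType) : polish_hom (G * H)%type G :=
  @PolishHom (G * H)%type G fst (fun _ _ => erefl) (fun x => @cvg_fst _ _ _ _ _).

Definition polish_snd (G H : polishGroupType) : polish_hom (G * H)%type H :=
  @PolishHom (G * H)%type H snd (fun _ _ => erefl) (fun x => @cvg_snd _ _ _ _ _).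

Definition polish_pair (K G H : polishGroupType) (f : polish_hom K G)
  (g : polish_hom K H) : polish_hom K (G * H)%type.
Proof.
apply: (@PolishHom K (G * H)%type (fun x => (f x, g x))).
  by move=> x y; rewrite !polish_homM.
by move=> x; apply: cvg_pair; apply: polish_hom_continuous.
Defined.

Definition polish_triv (G H : polishGroupType) : polish_hom G H.
Proof.
apply: (@PolishHom G H (fun=> 1%g)); first by move=> x y; rewrite mulg1.
by move=> x; apply: cvg_cst.
Defined.

Lemma closed_polish_eq (G H : polishGroupType) (f g : polish_hom G H) :
  closed [set x | f x = g x].
Proof.
move=> x cx; apply: completely_metrizable_closure.
  exact: polish_completely_metrizable.
move=> A nA W nW.
have nf : nbhs x (f @^-1` A) by apply: (@polish_hom_continuous _ _ f).
have ng : nbhs x (g @^-1` W) by apply: (@polish_hom_continuous _ _ g).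
have [z [/= fg [/= Az Wz]]] := cx _ (filterI nf ng).
by exists (f z); split => //=; rewrite fg.
Qed.

(** Equalizing a whole family at once, with control of points, serves pullbacks, kernels and general
    finite limits alike. *)
Lemma polish_equalizer (G : polishGroupType) (I : Type) (H : I -> polishGroupType)
    (f g : forall i, polish_hom G (H i)) :
  exists (K : polishGroupType) (k : polish_hom K G),
    [/\ injective k, forall x, (forall i, f i x = g i x) <-> exists z, k z = x &
    forall (U : polishGroupType) (u : polish_hom U G),
      (forall i x, f i (u x) = g i (u x)) ->
      exists w : polish_hom U K, forall x, k (w x) = u x].
Proof.
pose A := [set x | forall i, f i x = g i x].
have sA : is_subgroup A.
  split=> [i|x y Ax Ay i|x Ax i]; first by rewrite !polish_hom1.
    by rewrite !polish_homM Ax Ay.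
  by rewrite !polish_homV Ax.
have cA : closed A.
  rewrite (_ : A = \bigcap_i [set x | f i x = g i x]).
    by apply: closed_bigI => i _; apply: closed_polish_eq.
  by apply/seteqP; split=> x Ax i; [move=> _; apply: Ax|exact: Ax i Logic.I].
have [K [k [[ki kA] ku]]] := closed_subgroup_polish sA cA.
exists K, k; split=> // [x|U u fg].
  by rewrite -[X in X <-> _]/(A x) -kA; split=> [[z _ <-]|[z <-]]; exists z.
by apply: ku => x i; apply: fg.
Qed.

Lemma polish_pullback_exists (X Y Z : polishGroupType) (f : polish_hom X Z)
    (g : polish_hom Y Z) :
  exists (P : polishGroupType) (p : polish_hom P X) (q : polish_hom P Y),
    @is_pullback polish_cat X Y Z P f g p q /\
    forall x y, f x = g y -> exists z, p z = x /\ q z = y.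
Proof.
have [P [k [ki kE ku]]] := @polish_equalizer (X * Y)%type unit (fun=> Z)
  (fun=> polish_comp f (polish_fst X Y)) (fun=> polish_comp g (polish_snd X Y)).
exists P, (polish_comp (polish_fst X Y) k), (polish_comp (polish_snd X Y) k).
split; last first.
  move=> x y fg; have [|z zE] := (kE (x, y)).1; first by case.
  by exists z; rewrite /= zE.
split; first by move=> z /=; apply: (kE (k z)).2 tt; exists z.
move=> U u v uv; have [_ x|w wE] := ku _ (polish_pair u v); first exact: uv.
exists w; split; first by split=> x /=; rewrite wE.
by move=> w' pw qw x; apply: ki; rewrite wE /= -pw -qw /= -surjective_pairing.
Qed.

(** The explicit pullback has the required points, and the universal property of [P] maps it to [P]
    over both legs. *)
Lemma polish_pullback_points (X Y Z P : polishGroupType) (f : polish_hom X Z)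
    (g : polish_hom Y Z) (p : polish_hom P X) (q : polish_hom P Y) :
  @is_pullback polish_cat X Y Z P f g p q ->
  forall x y, f x = g y -> exists z, p z = x /\ q z = y.
Proof.
move=> [_ up] x y fg.
have [P' [p' [q' [[c' _] pt]]]] := polish_pullback_exists f g.
have [w [[pw qw] _]] := up P' p' q' c'.
have [z [<- <-]] := pt x y fg.
by exists (polish_fun w z); split; [apply: pw|apply: qw].
Qed.

(** Joint monicity is tested on the kernel pair of [(l, r)], whose points are the pairs to be
    identified. *)
Lemma polish_jointly_injective (K X Y : polishGroupType) (l : polish_hom K X)
    (r : polish_hom K Y) : @jointly_monic polish_cat K X Y l r ->
  forall s t, l s = l t -> r s = r t -> s = t.
Proof.
move=> lr s t ls rs.
have [P [p [q [[c _] pt]]]] :=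
  polish_pullback_exists (polish_pair l r) (polish_pair l r).
have pq : @eqh polish_cat P K p q.
  by apply: lr => z; have /= [] := c z.
have [|z [<- <-]] := pt s t; first by rewrite /= ls rs.
exact: pq.
Qed.

(** The set-theoretic section [s] need not be continuous, but [u \o s] does not depend on its choice
    and is continuous because [f] is open. *)
Lemma polish_surj_factor (G H K : polishGroupType) (f : polish_hom G H)
    (u : polish_hom G K) : (forall y, exists x, f x = y) ->
  (forall x x', f x = f x' -> u x = u x') ->
  exists w : polish_hom H K, forall x, w (f x) = u x.
Proof.
move=> fs fu; have [s sP] := choice fs.
have wE x : u (s (f x)) = u x by apply: fu; rewrite sP.
have wM : {morph u \o s : x y / (x * y)%g}.
  by move=> x y /=; rewrite -{1}(sP x) -{1}(sP y) -polish_homM wE polish_homM.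
have wc : continuous (u \o s).
  move=> y; have [x <-] := fs y; move=> A /=; rewrite wE.
  move=> /(@polish_hom_continuous _ _ u) /(polish_open_mapping fs).
  by apply: filterS => _ [z /= Az <-]; rewrite /= wE.
by exists (PolishHom wM wc).
Qed.

Lemma polish_surj_coequalizer (G H P : polishGroupType) (f : polish_hom G H)
    (p q : polish_hom P G) : (forall y, exists x, f x = y) ->
  (forall z, f (p z) = f (q z)) ->
  (forall x x', f x = f x' -> exists z, p z = x /\ q z = x') ->
  @is_coequalizer polish_cat P G H p q f.
Proof.
move=> fs fpq pq; split; first exact: fpq.
move=> U u upq; have [|w wE] := polish_surj_factor (u := u) fs.
  by move=> x x' /pq [z [<- <-]]; apply: upq.
exists w; split=> // w' w'E y; have [x <-] := fs y.
by rewrite wE; apply: w'E.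
Qed.

Lemma polish_regular_epiP (G H : polishGroupType) (f : polish_hom G H) :
  @regular_epi polish_cat G H f <-> forall y, exists x, f x = y.
Proof.
split=> [[A [a [b [ab up]]]]|fs].
  (* The map [e] onto the image also coequalizes, so it factors as [w] after [f]; uniqueness gives
     [m] after [w] equal to the identity, hence the image is everything. *)
  have [Q [e [m [es mi mE]]]] := polish_image_factorization f.
  have [|w [we _]] := up Q e.
    by move=> x; apply: mi; rewrite /= !mE; apply: ab.
  have [w0 [_ w0u]] := up H f ab.
  have h1 : @eqh polish_cat H H (polish_comp m w) w0.
    by apply: w0u => x /=; rewrite -[RHS]mE; congr (m _); apply: we.
  have h2 : @eqh polish_cat H H (polish_id H) w0 by apply: w0u.
  move=> y; have [x xE] := es (polish_fun w y); exists x.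
  by rewrite -mE xE; rewrite -[LHS]/(polish_comp m w y) h1 -h2.
have [P [p [q [[c _] pt]]]] := polish_pullback_exists f f.
by exists P, p, q; apply: polish_surj_coequalizer.
Qed.

Definition trivial_group : Type := unit.
HB.instance Definition _ := Choice.on trivial_group.

Section TrivialGroup.
Let one : trivial_group := tt.
Let mul (x y : trivial_group) : trivial_group := tt.
Let inv (x : trivial_group) : trivial_group := tt.
Let eq_all (x y : trivial_group) : x = y. Proof. by case: x; case: y. Qed.
Let mulA : associative mul. Proof. by []. Qed.
Let mul1 : left_id one mul. Proof. by case. Qed.
Let mulr1 : right_id one mul. Proof. by case. Qed.
Let mulV : left_inverse one inv mul. Proof. by []. Qed.
Let mulrV : right_inverse one inv mul. Proof. by []. Qed.
HB.instance Definition _ :=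
  isGroup.Build trivial_group mulA mul1 mulr1 mulV mulrV.
HB.instance Definition _ := @isOpenTopological.Build trivial_group setT I
  (fun _ _ _ _ => I) (fun _ _ _ => I).
Let nbhs1 (x : trivial_group) (A : set trivial_group) : A x -> nbhs x A.
Proof. by move=> Ax; apply: open_nbhs_nbhs. Qed.
Let mulC : continuous (fun x : trivial_group * trivial_group => (x.1 * x.2)%g).
Proof.
move=> x A /nbhs_singleton Ax; apply: filterS filterT => y _ /=.
by rewrite (eq_all y (x.1 * x.2)%g).
Qed.
Let invC : continuous (fun x : trivial_group => x^-1%g).
Proof. by move=> x A /nbhs_singleton Ax; exact: (@nbhs1 x [set z | A z^-1%g]). Qed.
Let cm : completely_metrizable trivial_group.
Proof.
exists (fun _ _ => 0%R); split.
- by split=> // x y z; rewrite addr0.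
- move=> x A; split; last by move=> [e e0 eA]; apply: nbhs1; apply: eA.
  by move=> /nbhs_singleton Ax; exists 1%R => // y _; rewrite (eq_all y x).
- move=> u _; exists one => A /nbhs_singleton A1; exists 0%N => // n _ /=.
  by rewrite (eq_all (u n) one).
Qed.
Let sep : separable trivial_group.
Proof.
exists setT; first exact: countableP.
by move=> O [x Ox] _; exists x.
Qed.
HB.instance Definition _ := isPolishGroup.Build trivial_group mulC invC cm sep.
End TrivialGroup.

(** Projections exist for every [v] but are controlled only on [s], which permits induction on a
    list; finite limits take [s] to be the enumeration of the vertices. *)
Lemma polish_product (V : eqType) (D : V -> polishGroupType) (s : seq V) :
  exists (P : polishGroupType) (p : forall v, polish_hom P (D v)),
    (forall x y, (forall v, v \in s -> p v x = p v y) -> x = y) /\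
    forall (U : polishGroupType) (u : forall v, polish_hom U (D v)),
      exists w : polish_hom U P, forall v x, v \in s -> p v (w x) = u v x.
Proof.
elim: s => [|v0 s [P [p [pi pu]]]].
  exists trivial_group, (fun v => polish_triv _ _); split; first by move=> [] [].
  by move=> U u; exists (polish_triv _ _).
have [v0s|v0s] := boolP (v0 \in s).
  exists P, p; split=> [x y xy|U u].
    by apply: pi => v vs; apply: xy; rewrite inE vs orbT.
  have [w wE] := pu U u; exists w => v x; rewrite inE => /predU1P[->|]; exact: wE.
(* The first factor has type [D v0], so its projection is transported along a proof of [v0 = v]; at
   [v0] itself uniqueness of identity proofs removes the cast. *)
pose p' v : polish_hom (D v0 * P)%type (D v) := match v0 =P v with
  | ReflectT e => polish_comp
      (ecast w (polish_hom (D v0) (D w)) e (polish_id (D v0))) (polish_fst _ _)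
  | ReflectF _ => polish_comp (p v) (polish_snd _ _) end.
have p'0 x : p' v0 x = x.1.
  by rewrite /p'; case: eqP => // e; rewrite (eq_axiomK e).
have p'1 v x : v \in s -> p' v x = p v x.2.
  by rewrite /p'; case: eqP => // e vs; rewrite e vs in v0s.
exists (D v0 * P)%type, p'; split.
  move=> [a x] [b y] xy; congr pair.
    by have := xy v0; rewrite !p'0; apply; rewrite inE eqxx.
  by apply: pi => v vs; have := xy v; rewrite !p'1 //; apply; rewrite inE vs orbT.
move=> U u; have [w wE] := pu U u; exists (polish_pair (u v0) w) => v x.
by rewrite inE => /predU1P[->|vs]; rewrite ?p'0 ?p'1 //; apply: wE.
Qed.

Lemma polish_has_finite_limits : has_finite_limits polish_cat.
Proof.
move=> D.
have [P [p [pi pu]]] := @polish_product (vertex D) (fun v => dob v) (enum (vertex D)).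
have [L [k [ki kE ku]]] := @polish_equalizer P (edge D) (fun e => dob (target e))
  (fun e => polish_comp (darr D e) (p (source e))) (fun e => p (target e)).
exists L, (fun v => polish_comp (p v) k); split.
  by move=> e x /=; apply: (kE (k x)).2 e; exists x.
move=> U u cu; have [w wE] := pu U u.
have [e x|h hE] := ku U w.
  by rewrite /= !wE ?mem_enum //; apply: cu.
exists h; split=> [v x|g gE x]; first by rewrite /= hE wE ?mem_enum.
apply: ki; apply: pi => v _; rewrite hE wE ?mem_enum //.
exact: gE.
Qed.

Lemma polish_regular : regular polish_cat.
Proof.
split; first exact: polish_has_finite_limits.
- move=> X Y P f p q pb.
  have [Q [e [m [es mi mE]]]] := polish_image_factorization f.
  exists Q, e; apply: polish_surj_coequalizer => //.
    by move=> z; apply: mi; rewrite !mE; apply: pb.1.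
  move=> x x' xx; apply: (polish_pullback_points pb).
  by rewrite -!mE xx.
- move=> X Y Z P f g p q pb /polish_regular_epiP gs; apply/polish_regular_epiP => x.
  have [y yE] := gs (polish_fun f x).
  by have [z [zx _]] := polish_pullback_points pb (esym yE); exists z.
Qed.

(** * Internal relations as sets of pairs *)

Section Relations.
Variables X Y : polishGroupType.
Implicit Types T : @crel polish_cat X Y.

Lemma crel_inj T (s t : (crel_ob T : polishGroupType)) :
  polish_fun (crel_l T) s = polish_fun (crel_l T) t ->
  polish_fun (crel_r T) s = polish_fun (crel_r T) t -> s = t.
Proof. by apply: polish_jointly_injective; apply: crel_monic. Qed.

(* The comparison [K -> U] from the pullback is bijective, hence a homeomorphism. *)
Lemma crel_mem_points T (U : polishGroupType) (x : polish_hom U X)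
    (y : polish_hom U Y) : @crel_mem polish_cat X Y T U x y <->
  forall z, graph_of T (x z, y z).
Proof.
split=> [[u [ul ur]] z|xy].
  by exists (polish_fun u z); split; [apply: ul|apply: ur].
have [K [p [q [[c up] pt]]]] :=
  polish_pullback_exists (polish_pair x y) (polish_pair (crel_l T) (crel_r T)).
have ps z : exists k, p k = z.
  have [t [tl tr]] := xy z; have [|k [pk _]] := pt z t; last by exists k.
  by rewrite /= tl tr.
have [|w wE] := polish_surj_factor (u := q) ps.
  move=> k k' pk; have /= [l1 r1] := c k; have /= [l2 r2] := c k'.
  by apply: crel_inj; rewrite -?l1 -?r1 -?l2 -?r2 pk.
by exists w; split=> z; have [k <-] := ps z; rewrite /= wE; have /= [] := c k.
Qed.

Lemma crel_le_graph T T' : crel_le T T' <-> graph_of T `<=` graph_of T'.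
Proof.
split=> [[i [il ir]] [x y] [t [/= <- <-]]|TT'].
  by exists (polish_fun i t); split; [apply: il|apply: ir].
have /crel_mem_points : forall t, graph_of T'
    (polish_fun (crel_l T) t, polish_fun (crel_r T) t).
  by move=> t; apply: TT'; exists t.
by [].
Qed.

Lemma crel_eq_graph T T' : crel_eq T T' <-> graph_of T = graph_of T'.
Proof.
split=> [[/crel_le_graph TT' /crel_le_graph T'T]|TT']; first exact/seteqP.
by split; apply/crel_le_graph; rewrite TT'.
Qed.

Lemma graph_of_op T x y : graph_of (crel_op T) (y, x) <-> graph_of T (x, y).
Proof. by split=> -[t [tl tr]]; exists t. Qed.

Lemma graph_of_subgroup T : is_subgroup (graph_of T).
Proof.
split.
- by exists 1%g; rewrite !polish_hom1.
- move=> [x y] [x' y'] [t [/= <- <-]] [t' [/= <- <-]]; exists (t * t')%g.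
  by rewrite !polish_homM.
- by move=> [x y] [t [/= <- <-]]; exists t^-1%g; rewrite !polish_homV.
Qed.

Definition crel_pair T : polish_hom (crel_ob T : polishGroupType) (X * Y)%type :=
  polish_pair (crel_l T) (crel_r T).

Lemma crel_polish_topology T : polish_topology (graph_of T) (crel_pair T).
Proof.
split; first by move=> s t [ls rs]; apply: crel_inj.
apply/seteqP; split=> [_ [t _ <-]|[x y] [t [/= <- <-]]]; last by exists t.
by exists t.
Qed.

End Relations.

Lemma graph_of_composite (X Y Z : polishGroupType) (S : @crel polish_cat Y Z)
    (R : @crel polish_cat X Y) (T : @crel polish_cat X Z) : is_composite S R T ->
  forall x z, graph_of T (x, z) <->
    exists y, graph_of R (x, y) /\ graph_of S (y, z).
Proof.
move=> [P [p [q [e [pb /polish_regular_epiP es el er]]]]] x z; split.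
  move=> [t [/= <- <-]]; have [k <-] := es t.
  exists (polish_fun (crel_r R) (polish_fun p k)); split.
    by exists (polish_fun p k); split=> //; symmetry; apply: el.
  exists (polish_fun q k); split; symmetry; [exact: pb.1|exact: er].
move=> [y [[s [/= <- sy]] [t [/= ty <-]]]].
have [|k [<- <-]] := polish_pullback_points pb (x := s) (y := t).
  by rewrite sy ty.
by exists (polish_fun e k); split; [apply: el|apply: er].
Qed.

Lemma graph_of_comp (regP : regular polish_cat) (X Y Z : polishGroupType)
    (S : @crel polish_cat Y Z) (R : @crel polish_cat X Y) x z :
  graph_of (crel_comp regP S R) (x, z) <->
    exists y, graph_of R (x, y) /\ graph_of S (y, z).
Proof. exact: (graph_of_composite (crel_compP regP S R)). Qed.

Section EquivalencePoints.
Variables (X : polishGroupType) (E : @crel polish_cat X X).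
Hypothesis eE : equivalence_relation E.

Lemma graph_of_refl x : graph_of E (x, x).
Proof.
by have /crel_le_graph := eqrel_refl eE; apply; exists x.
Qed.

End EquivalencePoints.

(** * The canonical functor *)

Section CanonicalSubgroup.
Variable X : ex_ob polish_cat.
Local Notation G := (ex_carrier X : polishGroupType).
Local Notation E := (ex_rel X).
Local Open Scope group_scope.

(** The class of 1 under [E]: this is the subgroup [N] with [E] the coset relation of [N]. *)
Definition class1 : set G := [set n | graph_of E (1, n)].

Lemma class1_polish : is_polish_subgroup class1.
Proof.
have [E1 EM EV] := graph_of_subgroup E.
split.
  split; first exact: E1.
    move=> x y Ex Ey; have := EM _ _ Ex Ey.
    by rewrite -[(_ * _)]/(1 * 1, x * y) mulg1.
  by move=> x Ex; have := EV _ Ex; rewrite -[(_, _)^-1]/(1^-1, x^-1) invg1.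
(* The Polish topology is that of the kernel of the left leg, which the right leg maps injectively
   onto [class1]. *)
have [K [k [ki kE _]]] := @polish_equalizer (crel_ob E) unit (fun=> G)
  (fun=> crel_l E) (fun=> polish_triv _ _).
exists K, (polish_comp (crel_r E) k); split.
  move=> s t st; apply: ki; apply: crel_inj => //.
  by rewrite !((kE _).2 (ex_intro _ _ erefl) tt).
apply/seteqP; split=> [_ [s _ <-]|n [t [tl tr]]].
  by exists (k s); split=> //; apply: ((kE _).2 (ex_intro _ _ erefl) tt).
have [|s sE] := (kE t).1; first by [].
by exists s => //=; rewrite sE.
Qed.

Lemma class1_normal x g : class1 x -> class1 (g^-1 * x * g).
Proof.
have [_ EM EV] := graph_of_subgroup E; have Eg := graph_of_refl (ex_equiv X) g.
(* Conjugate [(1, x)] by the diagonal pair [(g, g)], which lies in [E] by reflexivity. *)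
move=> Ex; have := EM _ _ (EM _ _ (EV _ Eg) Ex) Eg.
by rewrite -[(_, _)^-1 * _ * _]/(g^-1 * 1 * g, g^-1 * x * g) mulg1 mulVg.
Qed.

Definition canonical_sub : normal_polish_subgroup G :=
  NormalPolishSubgroup class1_polish class1_normal.

End CanonicalSubgroup.

Local Notation canonical_cover := (canon_cover canonical_sub).

Lemma coset_graph (X : ex_ob polish_cat) (x y : (ex_carrier X : polishGroupType)) :
  @coset (canonical_cover X) x = @coset (canonical_cover X) y <->
  graph_of (ex_rel X) (x, y).
Proof.
have [_ EM EV] := graph_of_subgroup (ex_rel X).
have Ex := graph_of_refl (ex_equiv X) x.
rewrite coset_eqP /= /class1 /=; split=> [/(EM _ _ Ex)|/(EM _ _ (EV _ Ex))].
  by rewrite -[(_ * _)%g]/(x * 1, x * (x^-1 * y))%g mulg1 mulVKg.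
by rewrite -[(_ * _)%g]/(x^-1 * x, x^-1 * y)%g mulVg.
Qed.

Lemma cosetM (A : polish_cover) (x y : cover_group A) :
  coset (x * y)%g = (coset x * coset y)%g.
Proof. by rewrite -quotient_mulE. Qed.

Section CanonicalHom.
Variables (regP : regular polish_cat) (X Y : ex_ob polish_cat).
Variable T : ex_hom regP X Y.
Local Notation G := (ex_carrier X : polishGroupType).
Local Notation H := (ex_carrier Y : polishGroupType).

Lemma ex_hom_total (x : G) : exists y, graph_of (ex_graph T) (x, y).
Proof.
have /crel_le_graph := ex_total T => /(_ (x, x) (graph_of_refl (ex_equiv X) x)).
by move=> /graph_of_comp [y [xy _]]; exists y.
Qed.

Lemma ex_hom_functional (x : G) (y y' : H) : graph_of (ex_graph T) (x, y) ->
  graph_of (ex_graph T) (x, y') -> graph_of (ex_rel Y) (y, y').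
Proof.
move=> xy xy'; have /crel_le_graph := ex_functional T; apply.
by apply/graph_of_comp; exists x; split => //; apply/graph_of_op.
Qed.

Lemma ex_hom_saturated (x x' : G) (y y' : H) : graph_of (ex_rel X) (x', x) ->
  graph_of (ex_rel Y) (y, y') -> graph_of (ex_graph T) (x, y) ->
  graph_of (ex_graph T) (x', y').
Proof.
have /crel_eq_graph sT := ex_source T; have /crel_eq_graph tT := ex_target T.
move=> xx yy xy; rewrite -sT; apply/graph_of_comp; exists x; split=> //.
by rewrite -tT; apply/graph_of_comp; exists y.
Qed.

Definition canonical_fun (q : cover_quotient (canonical_cover X)) :
    cover_quotient (canonical_cover Y) :=
  @coset (canonical_cover Y) (sval (cid (ex_hom_total (repr q)))).

Lemma canonical_funE (x : G) (y : H) : graph_of (ex_graph T) (x, y) ->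
  canonical_fun (@coset (canonical_cover X) x) = @coset (canonical_cover Y) y.
Proof.
move=> xy; rewrite /canonical_fun; set r := repr _; case: cid => y' /= ry'.
apply/coset_graph; apply: ex_hom_functional xy.
apply: ex_hom_saturated ry'; last exact: graph_of_refl (ex_equiv Y) _.
by apply/coset_graph; rewrite /coset reprK.
Qed.

(** Saturation of [T] under the target relation recovers every pair of the lifted graph from a
    single chosen value. *)
Lemma canonical_lifted_graph :
  @lifted_graph (canonical_cover X) (canonical_cover Y) canonical_fun =
  graph_of (ex_graph T).
Proof.
apply/seteqP; split=> -[x y] /=; last exact: canonical_funE.
have [y' xy'] := ex_hom_total x; rewrite /lifted_graph /= (canonical_funE xy').
move=> /coset_graph yy; apply: ex_hom_saturated xy' => //.
exact: graph_of_refl (ex_equiv X) _.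
Qed.

Lemma canonical_funM : {morph canonical_fun : p q / (p * q)%g}.
Proof.
move=> p q; have [x <-] := coset_surj p; have [x' <-] := coset_surj q.
have [y xy] := ex_hom_total x; have [y' xy'] := ex_hom_total x'.
have [_ TM _] := graph_of_subgroup (ex_graph T).
have xxyy : graph_of (ex_graph T) (x * x', y * y')%g by have := TM _ _ xy xy'.
by rewrite -cosetM (canonical_funE xy) (canonical_funE xy') (canonical_funE xxyy) -cosetM.
Qed.

(** The left leg of [T] is onto by totality; a Borel section of it followed by the right leg is a
    Borel lift. *)
Lemma canonical_fun_borel : borel_definable canonical_fun.
Proof.
have [|s bs sE] := @polish_hom_borel_section _ _ (crel_l (ex_graph T)).
  by move=> x; have [y [t [tl _]]] := ex_hom_total x; exists t.
exists (polish_fun (crel_r (ex_graph T)) \o s).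
  apply: borel_function_comp bs; apply: continuous_borel.
  exact: polish_hom_continuous.
by move=> g; apply: canonical_funE; exists (s g).
Qed.

Definition canonical_hom : @hom cover_cat (canonical_cover X) (canonical_cover Y) :=
  CoverHom canonical_funM canonical_fun_borel.

End CanonicalHom.

Definition canonical_on (regP : regular polish_cat) :
  @functor_on (exact_completion regP) cover_cat canonical_cover.
Proof.
apply: (@FunctorOn (exact_completion regP) cover_cat canonical_cover
  (@canonical_hom regP)).
- move=> X Y S T /crel_eq_graph ST q; have [x <-] := coset_surj q.
  have [y xy] := ex_hom_total S x; rewrite /= (canonical_funE xy).
  by rewrite ST in xy; rewrite (canonical_funE xy).
- move=> X q; have [x <-] := coset_surj q.
  by apply: canonical_funE; apply: graph_of_refl (ex_equiv X) _.
- move=> X Y Z S T q; have [x <-] := coset_surj q.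
  have [y xy] := ex_hom_total T x; have [z yz] := ex_hom_total S y.
  rewrite /= (canonical_funE xy) (canonical_funE yz); apply: canonical_funE.
  by apply/graph_of_comp; exists y.
Defined.

Lemma canonical_subE (X : ex_ob polish_cat) :
  graph_of (ex_rel X) = @coset_relation (canonical_cover X).
Proof. by apply/seteqP; split=> -[x y] /coset_graph. Qed.

Definition canonical_PC (regP : regular polish_cat) : canonical_functor regP :=
  @CanonicalFunctor regP canonical_sub canonical_subE (canonical_on regP)
    (fun X Y T g h => @canonical_funE regP X Y T g h).

(** * The equivalence for a regular subcategory *)

Section FullyFaithful.
Variables (C D : category) (F : functor C D).
Hypothesis faith : forall (X Y : C) (f g : hom X Y), fmap F f =h fmap F g -> f =h g.
Hypothesis full : forall (X Y : C) (h : hom (F X) (F Y)), exists f, fmap F f =h h.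
Hypothesis ess : forall Y : D, exists X : C, isomorphic (F X) Y.

Let G (Y : D) : C := sval (cid (ess Y)).
Let e (Y : D) : hom (F (G Y)) Y := sval (cid (svalP (cid (ess Y)))).
Let iso_e (Y : D) : is_iso (e Y) := svalP (cid (svalP (cid (ess Y)))).
Let e' (Y : D) : hom Y (F (G Y)) := sval (cid (iso_e Y)).

Let e'e (Y : D) : e' Y \oh e Y =h idh (F (G Y)).
Proof. exact: (svalP (cid (iso_e Y))).1. Qed.

Let ee' (Y : D) : e Y \oh e' Y =h idh Y.
Proof. exact: (svalP (cid (iso_e Y))).2. Qed.

Let lift (X Y : C) (h : hom (F X) (F Y)) : hom X Y := sval (cid (full h)).
Let liftE (X Y : C) (h : hom (F X) (F Y)) : fmap F (lift h) =h h.
Proof. exact: svalP (cid (full h)). Qed.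

Let Gmap (Y Z : D) (h : hom Y Z) : hom (G Y) (G Z) := lift (e' Z \oh h \oh e Y).

Let Gon : functor_on G.
Proof.
apply: (@FunctorOn D C G Gmap).
- move=> Y Z h k hk; apply: faith; rewrite !liftE.
  by apply: comph_eqh (eqh_refl _); apply: comph_eqh (eqh_refl _) hk.
- move=> Y; apply: faith; rewrite liftE fmap_id comph1; exact: e'e.
- move=> X Y Z k h; apply: faith; rewrite fmap_comp !liftE -!comphA.
  apply: comph_eqh; first reflexivity.
  apply: comph_eqh; first reflexivity.
  rewrite !comphA ee' comp1h; reflexivity.
Defined.

(** Objects and preimages of arrows are chosen; every law for the inverse is checked after applying
    [F] and reflected by faithfulness. *)
Theorem fully_faithful_equivalence : is_equivalence F.
Proof.
exists (Functor Gon); split.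
  exists (fun X => lift (e (F X))); split.
    move=> X; exists (lift (e' (F X))).
    split; apply: faith; rewrite fmap_comp !liftE fmap_id; [exact: e'e|exact: ee'].
  move=> X Y f; apply: faith.
  rewrite -[fmap (functor_comp _ _) f]/(lift (e' (F Y) \oh fmap F f \oh e (F X))).
  rewrite !fmap_comp !liftE !comphA ee' comp1h; reflexivity.
exists e; split; first exact: iso_e.
move=> X Y h; rewrite -[fmap (functor_comp _ _) h]/(fmap F (lift (e' Y \oh h \oh e X))).
rewrite liftE !comphA ee' comp1h; reflexivity.
Qed.

End FullyFaithful.

Definition polish_prod_map (G G' H H' : polishGroupType) (f : polish_hom G G')
    (g : polish_hom H H') : polish_hom (G * H)%type (G' * H')%type :=
  polish_pair (polish_comp f (polish_fst G H)) (polish_comp g (polish_snd G H)).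

(** * Relations and covers in a regular subcategory *)

Section RegularSubcategory.
Variables (S : polish_cat -> Prop) (regS : regular_subcategory S).
Local Notation C := (full_subcategory S).
Local Notation regC := (subcategory_regular regS).
Local Notation regF := (inclusion_regular regS).
Local Notation regP := polish_regular.
Local Notation J := (fmap_crel regF).

Lemma in_upto_isoP (K : polishGroupType) : in_upto_iso S K <->
  exists (L : polishGroupType) (a : polish_hom K L) (b : polish_hom L K),
    [/\ S L, cancel a b & cancel b a].
Proof.
split=> [[L SL [a [b [ba ab]]]]|[L [a [b [SL ab ba]]]]]; first by exists L, a, b.
by exists L => //; exists a, b.
Qed.

(** The same Polish group [K] presents [A] and its injective image [B]. This moves lifted graphs
    along isomorphisms of the covering groups. *)
Lemma polish_subgroup_in_image (G H : polishGroupType) (f : polish_hom G H)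
    (A : set G) (B : set H) : injective f ->
  (forall y, B y <-> exists x, A x /\ f x = y) ->
  polish_subgroup_in S A -> polish_subgroup_in S B.
Proof.
move=> fi BE [K [i [[ii iA] SK]]]; exists K, (polish_comp f i); split=> //.
split; first by move=> s t /fi /ii.
apply/seteqP; split=> [_ [s _ <-]|y /BE [x [+ <-]]].
  by apply/BE; exists (i s); split=> //; rewrite -iA; exists s.
by rewrite -iA => -[s _ <-]; exists s.
Qed.

Section SRelations.
Variables X Y : C.
Implicit Types T : crel X Y.

(** By fullness, a comparison arrow in Polish groups between objects of [S] is already an arrow of
    the subcategory. *)
Lemma S_crel_le T T' : crel_le T T' <->
  graph_of (J T) `<=` graph_of (J T').
Proof.
by rewrite -crel_le_graph; split=> -[i [il ir]]; exists i.
Qed.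

Lemma S_crel_eq T T' : crel_eq T T' <-> graph_of (J T) = graph_of (J T').
Proof. by rewrite /crel_eq !S_crel_le; split=> [?|->]; [exact/seteqP|split]. Qed.

Lemma graph_polish_subgroup_in T : polish_subgroup_in S (graph_of (J T)).
Proof.
exists (sval (crel_ob T)), (crel_pair (J T)); split.
  exact: crel_polish_topology.
apply/in_upto_isoP; exists (sval (crel_ob T)), (polish_id _), (polish_id _).
by split=> //; apply: (svalP (crel_ob T)).
Qed.

(** Precomposing the inclusion with [b] replaces [K] by the object [L] of [S] without changing the
    range. *)
Lemma S_crel_exists (A : set ((sval X : polishGroupType) * (sval Y : polishGroupType))) :
  polish_subgroup_in S A -> exists T, graph_of (J T) = A.
Proof.
move=> [K [i [[ii iA] /in_upto_isoP [L [a [b [SL ab ba]]]]]]].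
pose l : @hom C (exist _ L SL) X := polish_comp (polish_fst _ _) (polish_comp i b).
pose r : @hom C (exist _ L SL) Y := polish_comp (polish_snd _ _) (polish_comp i b).
have lr : jointly_monic l r.
  move=> U u v lu ru z; apply: (can_inj ba); apply: ii.
  rewrite [LHS]surjective_pairing [RHS]surjective_pairing; congr pair.
    exact: lu.
  exact: ru.
exists (CRel lr); rewrite -iA; apply/seteqP; split=> [[x y] [t [/= <- <-]]|[x y]].
  by exists (b t) => //; rewrite -surjective_pairing.
by move=> [s _ sE]; exists (a s); rewrite /= ab sE.
Qed.

End SRelations.

(** Regularity of the inclusion enters here: pullbacks and images formed in [S] agree with those of
    Polish groups, so composites have the expected points. *)
Lemma S_graph_comp (X Y Z : C) (U : crel Y Z) (T : crel X Y) x z :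
  graph_of (J (crel_comp regC U T)) (x, z) <->
  exists y, graph_of (J T) (x, y) /\ graph_of (J U) (y, z).
Proof.
have /crel_eq_graph -> := fmap_crel_comp regC regP regF U T.
exact: graph_of_comp.
Qed.

Lemma S_graph_op (X Y : C) (T : crel X Y) x y :
  graph_of (J (crel_op T)) (y, x) <-> graph_of (J T) (x, y).
Proof. by split=> -[t [tl tr]]; exists t. Qed.

(** For composition, the covering groups are replaced by isomorphic objects of [S]. The lifted
    graphs become internal relations there, whose composite exists in [S] and is transported
    back. *)
Lemma S_cover_subcategory : is_subcategory (S_cover S) (S_definable S).
Proof.
split.
- move=> A B f g _ _ fg; rewrite /S_definable.
  by rewrite (_ : cover_fun f = cover_fun g) //; apply/funext.
(* The lifted graph of the identity is the coset relation. *)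
- move=> A [_ SE]; exact: SE.
- move=> A B D g f [/in_upto_isoP [X [a [a' [SX aa' a'a]]]] _]
    [/in_upto_isoP [Y [b [b' [SY bb' b'b]]]] _]
    [/in_upto_isoP [Z [c [c' [SZ cc' c'c]]]] _] Sg Sf.
  have [T TE] : exists T : @crel C (exist _ X SX) (exist _ Y SY),
      graph_of (J T) = [set p | lifted_graph (cover_fun f) (a' p.1, b' p.2)].
    apply: S_crel_exists; apply: (@polish_subgroup_in_image _ _ (polish_prod_map a b)) Sf.
      by move=> [x y] [x' y'] /= [/(can_inj aa') -> /(can_inj bb') ->].
    move=> [x y]; split; first by exists (a' x, b' y); rewrite /= a'a b'b.
    by move=> [[x' y'] /= [xy [<- <-]]]; rewrite /= aa' bb'.
  have [U UE] : exists U : @crel C (exist _ Y SY) (exist _ Z SZ),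
      graph_of (J U) = [set p | lifted_graph (cover_fun g) (b' p.1, c' p.2)].
    apply: S_crel_exists; apply: (@polish_subgroup_in_image _ _ (polish_prod_map b c)) Sg.
      by move=> [x y] [x' y'] /= [/(can_inj bb') -> /(can_inj cc') ->].
    move=> [x y]; split; first by exists (b' x, c' y); rewrite /= b'b c'c.
    by move=> [[x' y'] /= [xy [<- <-]]]; rewrite /= bb' cc'.
  apply: (@polish_subgroup_in_image _ _ (polish_prod_map a' c'))
    (graph_polish_subgroup_in (crel_comp regC U T)).
    by move=> [x y] [x' y'] /= [/(can_inj a'a) -> /(can_inj c'c) ->].
  move=> [x z]; rewrite /lifted_graph /=; split.
    move=> gf; have [y yE] := coset_surj (cover_fun f (coset x)).
    exists (a x, c z); rewrite /= aa' cc'; split=> //.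
    apply/S_graph_comp; exists (b y); rewrite TE UE /lifted_graph /= aa' bb' cc'.
    by rewrite yE.
  move=> [[x' z'] [/S_graph_comp [y []]]]; rewrite TE UE /lifted_graph /=.
  by move=> fy gy [<- <-]; rewrite fy.
Qed.

Local Notation Psi := (functor_comp (canonical (canonical_PC regP))
  (exact_completion_functor regC regP regF)).

Lemma Psi_S_cover (X : exact_completion regC) : S_cover S (Psi X).
Proof.
split.
  apply/in_upto_isoP; exists (sval (ex_carrier X)), (polish_id _), (polish_id _).
  by split=> //; apply: (svalP (ex_carrier X)).
have : polish_subgroup_in S (graph_of (ex_rel (ex_fmap_ob regC regF X))).
  exact: graph_polish_subgroup_in.
by rewrite canonical_subE.
Qed.

Lemma Psi_graph (X Y : exact_completion regC) (T : hom X Y) :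
  lifted_graph (cover_fun (fmap Psi T)) = graph_of (J (ex_graph T)).
Proof. exact: (canonical_lifted_graph (ex_fmap regP regF T)). Qed.

Lemma Psi_S_definable (X Y : exact_completion regC) (T : hom X Y) :
  S_definable S (fmap Psi T).
Proof. rewrite /S_definable Psi_graph; exact: graph_polish_subgroup_in. Qed.

Lemma Psi_faithful (X Y : exact_completion regC) (T U : hom X Y) :
  fmap Psi T =h fmap Psi U -> T =h U.
Proof.
move=> TU; apply/S_crel_eq; rewrite -!Psi_graph.
rewrite (_ : cover_fun (fmap Psi T) = cover_fun (fmap Psi U)) //.
exact/funext.
Qed.

Lemma Psi_coset (X : exact_completion regC)
    (x y : (sval (ex_carrier X) : polishGroupType)) :
  @coset (Psi X) x = @coset (Psi X) y <-> graph_of (J (ex_rel X)) (x, y).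
Proof. exact: coset_graph. Qed.

(** The lifted graph itself serves as [T]. On points, the four laws say that it is saturated on both
    sides, total, and single-valued modulo the target relation. *)
Lemma Psi_full (X Y : exact_completion regC) (f : hom (Psi X) (Psi Y)) :
  S_definable S f -> exists T : hom X Y, fmap Psi T =h f.
Proof.
move=> /(@S_crel_exists (ex_carrier X) (ex_carrier Y)) [T TE].
have TP x y : graph_of (J T) (x, y) <->
    cover_fun f (@coset (Psi X) x) = @coset (Psi Y) y by rewrite TE.
have h1 : crel_eq (crel_comp regC T (ex_rel X)) T.
  apply/S_crel_eq/seteqP; split=> -[x y].
    by move=> /S_graph_comp [x' [/Psi_coset xx /TP xy]]; apply/TP; rewrite xx.
  by move=> xy; apply/S_graph_comp; exists x; split=> //; apply/Psi_coset.
have h2 : crel_eq (crel_comp regC (ex_rel Y) T) T.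
  apply/S_crel_eq/seteqP; split=> -[x y].
    by move=> /S_graph_comp [y' [/TP xy /Psi_coset yy]]; apply/TP; rewrite xy.
  by move=> xy; apply/S_graph_comp; exists y; split=> //; apply/Psi_coset.
have h3 : crel_le (ex_rel X) (crel_comp regC (crel_op T) T).
  apply/S_crel_le => -[x x'] /Psi_coset xx; apply/S_graph_comp.
  have [y yE] := coset_surj (cover_fun f (@coset (Psi X) x)).
  exists y; split; first exact/TP.
  by apply/S_graph_op/TP; rewrite -xx.
have h4 : crel_le (crel_comp regC T (crel_op T)) (ex_rel Y).
  apply/S_crel_le => -[y y'] /S_graph_comp [x [/S_graph_op /TP xy /TP xy']].
  by apply/Psi_coset; rewrite -xy.
exists (ExHom h1 h2 h3 h4) => q; have [x <-] := coset_surj q.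
have [y yE] := coset_surj (cover_fun f (@coset (Psi X) x)).
rewrite -yE.
by apply: (@canonical_funE regP _ _ (ex_fmap regP regF (ExHom h1 h2 h3 h4))); apply/TP.
Qed.

(** The arrow witnessing transitivity comes from [crel_mem_points] in Polish groups; fullness makes
    it an arrow of the subcategory. *)
Lemma S_equivalence_relation (X : C) (E : crel X X) :
  (forall x, graph_of (J E) (x, x)) ->
  (forall x y, graph_of (J E) (x, y) -> graph_of (J E) (y, x)) ->
  (forall x y z, graph_of (J E) (x, y) -> graph_of (J E) (y, z) ->
     graph_of (J E) (x, z)) ->
  equivalence_relation E.
Proof.
move=> Er Es Et; split.
- by apply/S_crel_le => -[x y] [t [/= <- <-]]; apply: Er.
- by apply/S_crel_le => -[x y] /S_graph_op /Es.
- move=> P p q [pq _].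
  have [z|t [tl tr]] := (@crel_mem_points _ _ (J E) (sval P)
      (polish_comp (crel_l E) p) (polish_comp (crel_r E) q)).2.
    apply: (Et _ (polish_fun (crel_r E) (polish_fun p z))).
      by exists (polish_fun p z).
    by exists (polish_fun q z); split=> //=; symmetry; apply: pq.
  by exists t.
Qed.

End RegularSubcategory.

(** * Isomorphisms of covers and essential surjectivity *)

Section CoverIso.
Variables (A B : polish_cover).
Variables (a : polish_hom (cover_group A) (cover_group B)).
Hypothesis aE : forall x y : cover_group A, coset x = coset y ->
  coset (a x) = coset (a y).

Definition cover_map_fun (q : cover_quotient A) : cover_quotient B :=
  coset (a (repr q)).

Lemma cover_map_funE x : cover_map_fun (coset x) = coset (a x).
Proof. by apply: aE; rewrite /coset reprK. Qed.

Lemma cover_map_funM : {morph cover_map_fun : p q / (p * q)%g}.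
Proof.
move=> p q; have [x <-] := coset_surj p; have [y <-] := coset_surj q.
by rewrite -cosetM !cover_map_funE polish_homM cosetM.
Qed.

Lemma cover_map_fun_borel : borel_definable cover_map_fun.
Proof.
exists a; first by apply: continuous_borel; apply: polish_hom_continuous.
exact: cover_map_funE.
Qed.

Definition cover_map : cover_hom A B := CoverHom cover_map_funM cover_map_fun_borel.

End CoverIso.

Theorem theorem4p13 (S : polish_cat -> Prop)
    (regS : regular_subcategory S) :
  exists (regP : regular polish_cat) (Phi : canonical_functor regP)
    (SC : is_subcategory (S_cover S) (S_definable S)),
    equivalence_onto
      (functor_comp (canonical Phi)
         (exact_completion_functor (subcategory_regular regS) regP
            (inclusion_regular regS)))
      SC.
Proof.
exists polish_regular, (canonical_PC polish_regular), (S_cover_subcategory regS).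
exists (Psi_S_cover (regS := regS)), (Psi_S_definable (regS := regS)).
apply: fully_faithful_equivalence.
- by move=> X Y T U; apply: Psi_faithful.
- by move=> X Y [f Sf]; have [T TE] := Psi_full Sf; exists T.
move=> [A SA]; have [/in_upto_isoP [L [a [b [SL ab ba]]]] SE] := SA.
(* The preimage of [A] in the exact completion is [L] with the coset relation of [A] transported
   along [a]. *)
have [E EE] : exists E : @crel (full_subcategory S) (exist _ L SL) (exist _ L SL),
    graph_of (fmap_crel (inclusion_regular regS) E) =
    [set p | @coset_relation A (b p.1, b p.2)].
  apply: S_crel_exists; apply: (@polish_subgroup_in_image _ _ _ (polish_prod_map a a)) SE.
    by move=> [x y] [x' y'] /= [/(can_inj ab) -> /(can_inj ab) ->].
  move=> [x y]; split; first by exists (b x, b y); rewrite /= !ba.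
  by move=> [[x' y'] /= [xy [<- <-]]]; rewrite /= !ab.
have eE : equivalence_relation E.
  apply: S_equivalence_relation; rewrite EE /coset_relation //=.
  by move=> x y z -> ->.
pose X : exact_completion (subcategory_regular regS) := ExOb eE.
pose QX := canon_cover canonical_sub
  (ex_fmap_ob (subcategory_regular regS) (inclusion_regular regS) X).
have XE (x y : cover_group QX) :
    coset x = coset y <-> @coset A (b x) = @coset A (b y).
  by rewrite coset_graph /= EE.
have bE (x y : cover_group QX) : coset x = coset y -> @coset A (b x) = @coset A (b y).
  by move/XE.
have aE (x y : cover_group A) : coset x = coset y -> @coset QX (a x) = @coset QX (a y).
  by move=> xy; apply/XE; rewrite !ab.
pose f : hom (QX : cover_cat) (A : cover_cat) := @cover_map QX A b bE.
pose g : hom (A : cover_cat) (QX : cover_cat) := @cover_map A QX a aE.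
have fE := cover_map_funE bE; have gE := cover_map_funE aE.
(* Definability must be shown for [f] and for its inverse: their lifted graphs are the images of the
   coset relation of [A] with [a] applied to the left and to the right coordinate respectively. *)
have Sf : S_definable S f.
  apply: (@polish_subgroup_in_image _ _ _ (polish_prod_map a (polish_id _))) SE.
    by move=> [x y] [x' y'] /= [/(can_inj ab) -> ->].
  move=> [x y]; rewrite /lifted_graph /= fE; split.
    by move=> xy; exists (b x, y); rewrite /= ba.
  by move=> [[x' y'] /= [xy [<- <-]]]; rewrite ab.
have Sg : S_definable S g.
  apply: (@polish_subgroup_in_image _ _ _ (polish_prod_map (polish_id _) a)) SE.
    by move=> [x y] [x' y'] /= [-> /(can_inj ab) ->].
  move=> [x y]; rewrite /lifted_graph /= gE; split.
    move=> /XE; rewrite ab => xy; by exists (x, b y); rewrite /= ba.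
  by move=> [[x' y'] /= [xy [<- <-]]]; rewrite (aE _ _ xy).
exists X, (exist _ f Sf), (exist _ g Sg); split=> q.
  by have [x <-] := coset_surj q; rewrite /= fE gE ba.
by have [x <-] := coset_surj q; rewrite /= gE fE ab.
Qed.
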